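(* Every basic set $\Omega$ of an Axiom A diffeomorphism $f$ of a compact Riemannian manifold admits Markov partitions of arbitrarily small diameter: for every $\varepsilon>0$ there exists a Markov partition $\mathcal{R}=\{R_1,\dots,R_m\}$ of $\Omega$ with $\max_i\mathrm{diam}(R_i)<\varepsilon$.
   Context: A compact $f$-invariant set $\Lambda$ is hyperbolic if there is a continuous $Df$-invariant splitting $T_\Lambda M=E^s\oplus E^u$ and constants $c>0,\lambda\in(0,1)$ with $\|Df^n_xv\|\le c\lambda^n\|v\|$ for $v\in E^s_x$ and $\|Df^{-n}_xv\|\le c\lambda^n\|v\|$ for $v\in E^u_x$, for all $x\in\Lambda$, $n\ge0$. A $C^r$ diffeomorphism ($r\ge1$) satisfies Axiom A if its nonwandering set $\Omega(f)$ is hyperbolic and periodic points are dense in $\Omega(f)$. The basic sets of $f$ are the sets $\Omega_1,\dots,\Omega_s$ of the unique decomposition $\Omega(f)=\Omega_1\cup\dots\cup\Omega_s$ into pairwise disjoint closed $f$-invariant sets on each of which $f$ is topologically transitive (each further being a finite disjoint union of closed sets cyclically permuted by $f$ on which the corresponding return power of $f$ is topologically mixing). Local manifolds: $W^s_\varepsilon(x)=\{y\in M: d(f^n(x),f^n(y))\le\varepsilon\ \forall n\ge0\}$ and $W^u_\varepsilon(x)=\{y\in M: d(f^{-n}(x),f^{-n}(y))\le\varepsilon\ \forall n\ge0\}$. Local product structure: a small $\varepsilon$ (the local manifold size) and $\delta_0>0$ are fixed such that for $x,y\in\Omega$ with $d(x,y)<\delta_0$ the set $W^s_{\varepsilon}(x)\cap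 W^u_{\varepsilon}(y)$ is a single point, belonging to $\Omega$, denoted $[x,y]$. (This fixed local manifold size is unrelated to the $\varepsilon$ of the claim.) Rectangles: $R\subset\Omega$ is a rectangle if $\mathrm{diam}(R)<\delta_0$ and $[x,y]\in R$ for all $x,y\in R$. It is proper if it is closed in $\Omega$ and $R=\overline{\mathrm{int}(R)}$, the interior being taken in $\Omega$. For $x\in R$ put $W^s(x,R)=W^s_\varepsilon(x)\cap R$, $W^u(x,R)=W^u_\varepsilon(x)\cap R$, where $\varepsilon$ is the local manifold size (larger than $\mathrm{diam}(R)$). A Markov partition of $\Omega$ is a finite collection $\{R_1,\dots,R_m\}$ of proper rectangles such that: (M1) $\Omega=\bigcup_iR_i$; (M2) $\mathrm{int}(R_i)\cap\mathrm{int}(R_j)=\emptyset$ for $i\ne j$; (M3) if $x\in\mathrm{int}(R_i)\cap f^{-1}(\mathrm{int}(R_j))$ then $f(W^u(x,R_i))\supset W^u(f(x),R_j)$ and $f(W^s(x,R_i))\subset W^s(f(x),R_j)$. *)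

(* Defs.v *)
From HB Require Import structures.
From mathcomp Require Import all_boot all_order all_algebra.
From mathcomp Require Import all_classical all_reals all_analysis.

Set Implicit Arguments.
Unset Strict Implicit.
Unset Printing Implicit Defensive.
Import Order.TTheory GRing.Theory Num.Theory.
Import numFieldNormedType.Exports.

Local Open Scope classical_set_scope.
Local Open Scope ring_scope.

(** * Maps of class C^k between open subsets of normed spaces

    In finite dimension, continuity of [x |-> 'd f x v] for every [v] is
    continuity of [x |-> 'd f x] for the operator norm. *)

Fixpoint Ck (R : realType) (V W : normedModType R) (k : nat) (U : set V)
    (f : V -> W) : Prop :=
  match k with
  | 0 => forall x, U x -> {for x, continuous f}
  | k'.+1 => (forall x, U x -> differentiable f x) /\
             (forall v, Ck k' U (fun x => 'd f x v))
  end.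

Definition smooth_on (R : realType) (V W : normedModType R) (U : set V)
    (f : V -> W) : Prop :=
  forall k, Ck k U f.

(** * Smooth manifolds without boundary, of dimension [n] *)

(* [cmap] is only relevant on [cdom], [cinv] on [ccod]; they are extended
   arbitrarily to total functions. *)
Record chart (R : realType) (M : topologicalType) (n : nat) := Chart {
  cdom : set M ;
  ccod : set 'rV[R]_n ;
  cmap : M -> 'rV[R]_n ;
  cinv : 'rV[R]_n -> M ;
  cdom_open : open cdom ;
  ccod_open : open ccod ;
  cmap_cod : forall x, cdom x -> ccod (cmap x) ;
  cinv_dom : forall u, ccod u -> cdom (cinv u) ;
  cmapK : forall x, cdom x -> cinv (cmap x) = x ;
  cinvK : forall u, ccod u -> cmap (cinv u) = u ;
  cmap_continuous : forall x, cdom x -> {for x, continuous cmap} ;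
  cinv_continuous : forall u, ccod u -> {for u, continuous cinv}
}.

Definition transition (R : realType) (M : topologicalType) (n : nat)
    (c c' : chart R M n) : 'rV[R]_n -> 'rV[R]_n :=
  cmap c' \o cinv c.

Definition overlap (R : realType) (M : topologicalType) (n : nat)
    (c c' : chart R M n) : set 'rV[R]_n :=
  [set u | ccod c u /\ cdom c' (cinv c u)].

(* The chosen chart [chart_at x] around [x] is used to represent the tangent
   space at [x] by R^n; see [tangent_map] and [tangent_coord]. *)
Record smooth_atlas (R : realType) (M : topologicalType) (n : nat) := SmoothAtlas {
  atlas : set (chart R M n) ;
  chart_at : M -> chart R M n ;
  chart_at_atlas : forall x, atlas (chart_at x) ;
  chart_at_dom : forall x, cdom (chart_at x) x ;
  transition_smooth : forall c c', atlas c -> atlas c' ->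
    smooth_on (overlap c c') (transition c c')
}.

Definition Ck_map (R : realType) (M : topologicalType) (n : nat)
    (A : smooth_atlas R M n) (k : nat) (f : M -> M) : Prop :=
  continuous f /\
  forall c c', atlas A c -> atlas A c' ->
    Ck k [set u | ccod c u /\ cdom c' (f (cinv c u))] (cmap c' \o f \o cinv c).

Definition Ck_diffeomorphism (R : realType) (M : topologicalType) (n : nat)
    (A : smooth_atlas R M n) (k : nat) (f finv : M -> M) : Prop :=
  [/\ cancel f finv, cancel finv f, Ck_map A k f & Ck_map A k finv].

(* The differential T_x M -> T_(f x) M, both tangent spaces being represented
   in the chosen charts at x and f x. *)
Definition tangent_map (R : realType) (M : topologicalType) (n : nat)
    (A : smooth_atlas R M n) (f : M -> M) (x : M) :
    {linear 'rV[R]_n -> 'rV[R]_n} :=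
  'd (cmap (chart_at A (f x)) \o f \o cinv (chart_at A x))
     (cmap (chart_at A x) x).

(* The coordinates in [c] of a vector of T_x M. *)
Definition tangent_coord (R : realType) (M : topologicalType) (n : nat)
    (A : smooth_atlas R M n) (c : chart R M n) (x : M) :
    {linear 'rV[R]_n -> 'rV[R]_n} :=
  'd (transition (chart_at A x) c) (cmap (chart_at A x) x).

(** * Riemannian metrics and the Riemannian distance *)

Definition gram_form (R : realType) (n : nat) (G : 'M[R]_n) (v w : 'rV[R]_n) : R :=
  (v *m G *m w^T) 0 0.

(* [gram c u] is the Gram matrix, in the chart [c], of the inner product on the
   tangent space at the point of coordinates [u]. *)
Record riemannian_metric (R : realType) (M : topologicalType) (n : nat)
    (A : smooth_atlas R M n) := RiemannianMetric {
  gram : chart R M n -> 'rV[R]_n -> 'M[R]_n ;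
  gram_smooth : forall c, atlas A c -> smooth_on (ccod c) (gram c) ;
  gram_sym : forall c u, atlas A c -> ccod c u -> (gram c u)^T = gram c u ;
  gram_pos : forall c u v, atlas A c -> ccod c u -> v != 0 ->
    0 < gram_form (gram c u) v v ;
  gram_transition : forall c c' u v w, atlas A c -> atlas A c' ->
    overlap c c' u ->
    gram_form (gram c u) v w =
    gram_form (gram c' (transition c c' u))
      ('d (transition c c') u v) ('d (transition c c') u w)
}.

Definition tangent_norm (R : realType) (M : topologicalType) (n : nat)
    (A : smooth_atlas R M n) (g : riemannian_metric A) (x : M)
    (v : 'rV[R]_n) : R :=
  Num.sqrt (gram_form (gram g (chart_at A x) (cmap (chart_at A x) x)) v v).

Definition speed (R : realType) (M : topologicalType) (n : nat)
    (A : smooth_atlas R M n) (g : riemannian_metric A) (c : chart R M n)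
    (u : R^o -> 'rV[R]_n) (t : R) : R :=
  Num.sqrt (gram_form (gram g c (u t)) (derive1 u t) (derive1 u t)).

(* [path_length g x y l]: some piecewise C^1 path from x to y has length l.
   The path is subdivided into C^1 pieces, each contained in a chart domain and
   parametrized by [0, 1]; the coordinate expression of a piece is extended to
   a C^1 map on the whole line. *)
Inductive path_length (R : realType) (M : topologicalType) (n : nat)
    (A : smooth_atlas R M n) (g : riemannian_metric A) :
    M -> M -> \bar R -> Prop :=
| path_length_nil (x : M) : path_length g x x 0%E
| path_length_cons (c : chart R M n) (u : R^o -> 'rV[R]_n) (y : M) (l : \bar R) :
    atlas A c -> Ck 1 setT u ->
    (forall t : R, 0 <= t <= 1 -> ccod c (u t)) ->
    path_length g (cinv c (u 1)) y l ->
    path_length g (cinv c (u 0)) y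
      ((\int[lebesgue_measure]_(t in `[0%R, 1%R])
          (speed g c u t)%:E) + l)%E.

(* Equal to +oo for points in different connected components. *)
Definition rdist (R : realType) (M : topologicalType) (n : nat)
    (A : smooth_atlas R M n) (g : riemannian_metric A) (x y : M) : \bar R :=
  ereal_inf [set l | path_length g x y l].

(* The metric structure carried by the type [M] is the Riemannian one. *)
Definition is_riemannian (R : realType) (M : pseudoMetricType R) (n : nat)
    (A : smooth_atlas R M n) (g : riemannian_metric A) : Prop :=
  forall (x y : M) (e : R), 0 < e -> ball x e y <-> (rdist g x y < e%:E)%E.

Definition rdiam (R : realType) (M : topologicalType) (n : nat)
    (A : smooth_atlas R M n) (g : riemannian_metric A) (B : set M) : \bar R :=
  ereal_sup [set rdist g p.1 p.2 | p in B `*` B].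

(** * Hyperbolicity and Axiom A *)

(* Around each point of L there is a local frame of E which is continuous on L. *)
Definition continuous_subbundle (R : realType) (M : topologicalType) (n : nat)
    (A : smooth_atlas R M n) (L : set M) (E : M -> {vspace 'rV[R]_n}) : Prop :=
  forall x, L x ->
    exists (U : set M) (d : nat) (X : 'I_d -> M -> 'rV[R]_n),
      [/\ open U, U x, U `<=` cdom (chart_at A x),
          (forall i, {within U `&` L, continuous (X i)}) &
          (forall y, U y -> L y ->
             basis_of (linfun (tangent_coord A (chart_at A x) y) @: E y)%VS
                      [seq X i y | i <- enum 'I_d])].

Definition hyperbolic (R : realType) (M : topologicalType) (n : nat)
    (A : smooth_atlas R M n) (g : riemannian_metric A) (f finv : M -> M)
    (L : set M) : Prop :=
  [/\ compact L, f @` L = L &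
  exists Es Eu : M -> {vspace 'rV[R]_n},
  [/\ (forall x, L x -> (Es x + Eu x)%VS = fullv /\ (Es x :&: Eu x)%VS = 0%VS),
      continuous_subbundle A L Es /\ continuous_subbundle A L Eu,
      (forall x, L x -> (linfun (tangent_map A f x) @: Es x)%VS = Es (f x) /\
                        (linfun (tangent_map A f x) @: Eu x)%VS = Eu (f x)) &
      exists c lambda : R, [/\ 0 < c, 0 < lambda < 1,
        (forall x k v, L x -> v \in Es x ->
           tangent_norm g (iter k f x) (tangent_map A (iter k f) x v)
             <= c * lambda ^+ k * tangent_norm g x v) &
        (forall x k v, L x -> v \in Eu x ->
           tangent_norm g (iter k finv x) (tangent_map A (iter k finv) x v)
             <= c * lambda ^+ k * tangent_norm g x v)]]].

Definition nonwandering (M : topologicalType) (f : M -> M) : set M :=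
  [set x | forall U, nbhs x U ->
     exists k, (0 < k)%N /\ (iter k f @` U) `&` U !=set0].

Definition periodic_points (M : Type) (f : M -> M) : set M :=
  [set x | exists k, (0 < k)%N /\ iter k f x = x].

Definition axiom_A (R : realType) (M : topologicalType) (n : nat)
    (A : smooth_atlas R M n) (g : riemannian_metric A) (f finv : M -> M) : Prop :=
  hyperbolic g f finv (nonwandering f) /\
  nonwandering f `<=` closure (nonwandering f `&` periodic_points f).

(** * Basic sets *)

Definition transitive_on (M : topologicalType) (f : M -> M) (L : set M) : Prop :=
  forall U V, open U -> open V -> U `&` L !=set0 -> V `&` L !=set0 ->
    exists k, (0 < k)%N /\ (iter k f @` (U `&` L)) `&` (V `&` L) !=set0.

Definition mixing_on (M : topologicalType) (f : M -> M) (L : set M) : Prop :=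
  forall U V, open U -> open V -> U `&` L !=set0 -> V `&` L !=set0 ->
    exists N, forall k, (N <= k)%N ->
      (iter k f @` (U `&` L)) `&` (V `&` L) !=set0.

(* [ordS] is the cyclic successor on 'I_p. *)
Definition cyclic_mixing_decomposition (M : topologicalType) (f : M -> M)
    (L : set M) : Prop :=
  exists (p : nat) (X : 'I_p -> set M),
    [/\ L = \bigcup_i X i, trivIset setT X, (forall i, closed (X i)),
        (forall i, f @` X i = X (ordS i)) &
        (forall i, mixing_on (iter p f) (X i))].

Definition spectral_decomposition (M : topologicalType) (f : M -> M)
    (s : nat) (Om : 'I_s -> set M) : Prop :=
  [/\ nonwandering f = \bigcup_i Om i, trivIset setT Om &
      forall i, [/\ Om i !=set0, closed (Om i), f @` Om i = Om i,
                    transitive_on f (Om i) &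
                    cyclic_mixing_decomposition f (Om i)]].

Definition basic_set (M : topologicalType) (f : M -> M) (Om : set M) : Prop :=
  exists (s : nat) (F : 'I_s -> set M) (i : 'I_s),
    spectral_decomposition f F /\ Om = F i.

(** * Local manifolds, rectangles and Markov partitions *)

(* The local unstable manifold W^u of [f] is [local_manifold] for the inverse
   of [f]. *)
Definition local_manifold (R : realType) (M : topologicalType) (n : nat)
    (A : smooth_atlas R M n) (g : riemannian_metric A) (f : M -> M)
    (eps : R) (x : M) : set M :=
  [set y | forall k, (rdist g (iter k f x) (iter k f y) <= eps%:E)%E].

Definition local_product_structure (R : realType) (M : topologicalType) (n : nat)
    (A : smooth_atlas R M n) (g : riemannian_metric A) (f finv : M -> M)
    (Om : set M) (eps delta : R) : Prop :=
  [/\ 0 < eps, 0 < delta, delta <= eps &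
      forall x y, Om x -> Om y -> (rdist g x y < delta%:E)%E ->
        exists z, Om z /\
          local_manifold g f eps x `&` local_manifold g finv eps y = [set z]].

(* The bracket [x, y]; meaningful when the two local manifolds meet in exactly
   one point. *)
Definition bracket (R : realType) (M : topologicalType) (n : nat)
    (A : smooth_atlas R M n) (g : riemannian_metric A) (f finv : M -> M)
    (eps : R) (x y : M) : M :=
  xget x (local_manifold g f eps x `&` local_manifold g finv eps y).

Definition rectangle (R : realType) (M : topologicalType) (n : nat)
    (A : smooth_atlas R M n) (g : riemannian_metric A) (f finv : M -> M)
    (Om : set M) (eps delta : R) (B : set M) : Prop :=
  [/\ B `<=` Om, (rdiam g B < delta%:E)%E &
      forall x y, B x -> B y -> B (bracket g f finv eps x y)].

(* For B `<=` Om, this is the interior of B relative to Om. *)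
Definition relint (M : topologicalType) (Om B : set M) : set M :=
  interior (B : set (subspace Om)).

Definition proper_rectangle (R : realType) (M : topologicalType) (n : nat)
    (A : smooth_atlas R M n) (g : riemannian_metric A) (f finv : M -> M)
    (Om : set M) (eps delta : R) (B : set M) : Prop :=
  [/\ rectangle g f finv Om eps delta B,
      closed (B : set (subspace Om)) &
      B = closure (relint Om B : set (subspace Om))].

Definition markov_partition (R : realType) (M : topologicalType) (n : nat)
    (A : smooth_atlas R M n) (g : riemannian_metric A) (f finv : M -> M)
    (Om : set M) (eps delta : R) (m : nat) (B : 'I_m -> set M) : Prop :=
  let Ws x C := local_manifold g f eps x `&` C in
  let Wu x C := local_manifold g finv eps x `&` C in
  [/\ forall i, proper_rectangle g f finv Om eps delta (B i),
      Om = \bigcup_i B i,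
      forall i j, i != j -> relint Om (B i) `&` relint Om (B j) = set0 &
      forall i j x, relint Om (B i) x -> relint Om (B j) (f x) ->
        Wu (f x) (B j) `<=` f @` Wu x (B i) /\
        f @` Ws x (B i) `<=` Ws (f x) (B j)].

(* Main.v *)
Require Import Defs.
From mathcomp Require Import all_boot all_order all_algebra.
From mathcomp Require Import all_classical all_reals all_analysis.
From mathcomp Require Import lra.
Import Order.TTheory GRing.Theory Num.Theory.
Import numFieldNormedType.Exports.
Local Open Scope classical_set_scope.
Local Open Scope ring_scope.

(** The construction is topological: it starts from compactness and the local
    product structure.  Uniqueness of the bracket forces expansiveness: if the
    whole orbits of x and y stay [eps0]-close, both points lie in
    W^s(x) meet W^u(x), which is a single point.  By compactness expansiveness
    is uniform ([lps_product_structure]), and it replaces contraction rates: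
    local stable sets are contracted, without a rate, by high iterates
    ([asymp_contract]); the bracket is small and uniformly continuous at small
    scale, where it satisfies the identities of a rectangular band
    ([bracket_scale_exists]); and pseudo-orbits are shadowed ([shadowing]).

    Following Bowen, fix a fine finite net and draw an edge s -> t when f maps
    the net point s close to the net point t.  The points whose forward and
    backward orbits follow paths of the net through s form a small closed
    rectangle [shadow_rect], and these rectangles cover.  Shadowing shows that
    [x, y] follows the forward path of x and the backward path of y
    ([follows_bracket]); hence following an edge s -> t maps stable slices of
    the s-rectangle into the t-rectangle and pulls unstable slices back
    ([shadow_rect_edge]).  This is a Markov cover; only the overlaps are wrong.

    To cut the overlaps, view each T_j as a product of an unstable and a stable
    slice, in which T_j meet T_k is a subproduct.  Two points are in the same
    cell when they lie in the same T_j and, in each of them, on the same side of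
    all the factors of these subproducts.  Cells are rectangles
    ([same_cell_br]), and f maps two points of a cell on a common stable slice
    into a common cell ([same_cell_image]): a Markov partition in the
    set-theoretic sense, obtained by algebra in rectangular bands alone.

    Finally take the closures of the interiors of the cells.  Cells are boolean
    combinations of finitely many closed sets, so their interiors have dense
    union ([same_cell_dense]) and the closures cover.  Near a point z of a cell
    that is the bracket of two interior points x and y, any w is recovered as
    [[w, x], [y, w]] from points near x and y; this makes interiors rectangles
    ([cell_int_br]) and lets the Markov property pass to interiors
    ([cell_int_stab]) and then to closures ([cell_clo_stab]).

    The hypotheses on (f, bracket) are stable under passing to (f^-1, opposite
    bracket), so unstable statements are stable statements for the inverse. *)

Set Implicit Arguments.
Unset Strict Implicit.
Unset Printing Implicit Defensive.

(** * Uniform local product structures *)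

(** If every index fails at some scale, then at the smallest of these
    finitely many scales no index is left. *)
Lemma finite_pigeonhole (R : realType) (I : finType) (P : I -> R -> Prop) :
  (forall i a c, c <= a -> P i c -> P i a) ->
  (forall a, 0 < a -> exists i, P i a) -> exists i, forall a, 0 < a -> P i a.
Proof.
move=> mono ex; apply: contrapT => noi.
have /choice[a Pa] : forall i, exists a, 0 < a /\ ~ P i a.
  move=> i; apply: contrapT => /forallNP h; apply: noi; exists i => a a0.
  by apply: contrapT => nP; exact: (h a).
have [c c0 hc] : exists2 c, 0 < c & forall i, i \in enum I -> ~ P i c.
  elim: (enum I) => [|i s [c c0 hc]]; first by exists 1.
  exists (Num.min c (a i)) => [|j]; first by rewrite lt_min c0; case: (Pa i).
  rewrite inE => /predU1P[->|/hc nj] Pj.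
    by apply: (Pa i).2; apply: mono Pj; rewrite ge_min lexx orbT.
  by apply: nj; apply: mono Pj; rewrite ge_min lexx.
have [i Pi] := ex c c0.
by apply: (hc i) => //; rewrite mem_enum.
Qed.

Section ProductStructure.
Variables (R : realType) (X : Type) (d : X -> X -> R) (Om : set X).
Variables (eps0 delta0 : R).

(** Membership of [y] in the local stable set of [x] of size [e] for [h];
    the local unstable set is the one of the inverse map. *)
Definition asymp (h : X -> X) (e : R) (x y : X) : Prop :=
  forall k, d (iter k h x) (iter k h y) <= e.

Definition unif_continuous_on (h : X -> X) : Prop :=
  forall e, 0 < e -> exists2 a, 0 < a & forall x y, Om x -> Om y ->
    d x y < a -> d (h x) (h y) < e.

(** The hypotheses come in pairs exchanged by [f <-> g] and
    [br x y <-> br y x], which is what makes [product_structure_flip] possible.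
    In [ps_expansive] the slack [a] above [eps0] lets expansiveness be applied to
    orbits that are only known to be near orbits staying [eps0]-close. *)
Record product_structure (f g : X -> X) (br : X -> X -> X) : Prop := {
  psd_refl : forall x, d x x = 0;
  psd_sym : forall x y, d x y = d y x;
  psd_triangle : forall x y z, d x z <= d x y + d y z;
  ps_eps0 : 0 < eps0;
  ps_delta0 : 0 < delta0;
  ps_fK : cancel f g;
  ps_gK : cancel g f;
  ps_fOm : forall x, Om x -> Om (f x);
  ps_gOm : forall x, Om x -> Om (g x);
  ps_fcont : unif_continuous_on f;
  ps_gcont : unif_continuous_on g;
  ps_expansive : forall e, 0 < e -> exists (N : nat) (a : R), 0 < a /\
    forall x y, Om x -> Om y ->
      (forall k, (k <= N)%N -> d (iter k f x) (iter k f y) <= eps0 + a /\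
                               d (iter k g x) (iter k g y) <= eps0 + a) ->
      d x y < e;
  ps_brOm : forall x y, Om x -> Om y -> d x y < delta0 -> Om (br x y);
  ps_brs : forall x y, Om x -> Om y -> d x y < delta0 -> asymp f eps0 x (br x y);
  ps_bru : forall x y, Om x -> Om y -> d x y < delta0 -> asymp g eps0 y (br x y);
  ps_br_unique : forall x y z, Om x -> Om y -> d x y < delta0 ->
    asymp f eps0 x z -> asymp g eps0 y z -> z = br x y }.

Lemma product_structure_flip f g br :
  product_structure f g br -> product_structure g f (fun x y => br y x).
Proof.
case=> d0 ds dt e0 de fK gK fO gO fc gc ex bO bs bu un; split => //.
- move=> e /ex[N [a [a0 h]]]; exists N, a; split=> // x y Ox Oy hk.
  by apply: h => // k /hk[].
- by move=> x y Ox Oy xy; apply: bO => //; rewrite ds.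
- by move=> x y Ox Oy xy; apply: bu => //; rewrite ds.
- by move=> x y Ox Oy xy; apply: bs => //; rewrite ds.
- by move=> x y z Ox Oy xy h1 h2; apply: un => //; rewrite ds.
Qed.

Section Basic.
Variables (f g : X -> X) (br : X -> X -> X).
Hypothesis PS : product_structure f g br.

Let dxx := psd_refl PS.
Let dC := psd_sym PS.
Let dT := psd_triangle PS.

Lemma d_ge0 x y : 0 <= d x y.
Proof. by have := dT x y x; rewrite dxx (dC y x); lra. Qed.

Lemma iterf_Om k x : Om x -> Om (iter k f x).
Proof. by move=> Ox; elim: k => //= k; exact: (ps_fOm PS). Qed.

Lemma iterg_Om k x : Om x -> Om (iter k g x).
Proof. by move=> Ox; elim: k => //= k; exact: (ps_gOm PS). Qed.

Lemma iter_cancel j k x : (j <= k)%N -> iter j g (iter k f x) = iter (k - j) f x.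
Proof.
move=> jk; rewrite -{1}(subnKC jk) iterD; move: (k - j)%N => m.
elim: j {jk} => // j IH.
by rewrite iterSr iterS (ps_fK PS).
Qed.

Lemma asymp_refl e x : 0 <= e -> asymp f e x x.
Proof. by move=> e0 k; rewrite dxx. Qed.

Lemma asymp_trans e1 e2 x y z :
  asymp f e1 x y -> asymp f e2 y z -> asymp f (e1 + e2) x z.
Proof. by move=> h1 h2 k; apply: le_trans (dT _ _ _) _; apply: lerD. Qed.

Lemma asymp_le e1 e2 x y : e1 <= e2 -> asymp f e1 x y -> asymp f e2 x y.
Proof. by move=> e12 h k; apply: le_trans (h k) _. Qed.

Lemma asymp_iter j e x y : asymp f e x y -> asymp f e (iter j f x) (iter j f y).
Proof. by move=> h k; rewrite -!iterD. Qed.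

Lemma unif_iter N e : 0 < e -> exists2 a, 0 < a & forall x y, Om x -> Om y ->
  d x y < a -> forall k, (k <= N)%N -> d (iter k f x) (iter k f y) < e.
Proof.
elim: N e => [|N IH] e e0.
  by exists e => // x y _ _ xy k; rewrite leqn0 => /eqP->.
have [b b0 hb] := ps_fcont PS e0.
have m0 : 0 < Num.min b e by rewrite lt_min b0.
have [a a0 ha] := IH _ m0.
exists a => // x y Ox Oy xy k; rewrite leq_eqVlt => /predU1P[->|kN]; last first.
  by have := ha x y Ox Oy xy k kN; rewrite lt_min => /andP[].
have := ha x y Ox Oy xy N (leqnn N); rewrite lt_min => /andP[h _].
by rewrite !iterS; apply: hb => //; exact: iterf_Om.
Qed.

(** Once [N <= k], the window of [N] steps on both sides of time [k] consists
    of nonnegative times, where the two orbits are [eps0]-close. *)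
Lemma asymp_contract e : 0 < e -> exists N, forall x y, Om x -> Om y ->
  asymp f eps0 x y -> forall k, (N <= k)%N -> d (iter k f x) (iter k f y) < e.
Proof.
move=> e0; have [N [a [a0 h]]] := ps_expansive PS e0.
exists N => x y Ox Oy xy k Nk; apply: h; [exact: iterf_Om..|] => j jN.
rewrite -!iterD !iter_cancel ?(leq_trans jN)//.
by split; (apply: le_trans (xy _) _; lra).
Qed.

(** Late times are handled by contraction and the finitely many early ones by
    uniform continuity. *)
Lemma asymp_small e : 0 < e -> exists2 a, 0 < a & forall x y, Om x -> Om y ->
  d x y < a -> asymp f eps0 x y -> asymp f e x y.
Proof.
move=> e0; have [N hN] := asymp_contract e0; have [a a0 ha] := unif_iter N e0.
exists a => // x y Ox Oy xy h k; apply: ltW.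
have [kN|/ltnW Nk] := leqP k N; first exact: ha.
exact: hN.
Qed.

End Basic.

Section StableLeg.
Variables (f g : X -> X) (br : X -> X -> X).
Hypothesis PS : product_structure f g br.
Let FS := product_structure_flip PS.
Let dxx := psd_refl PS.
Let dC := psd_sym PS.
Let dT := psd_triangle PS.

(** The bracket stays with [x] in the future and with [y], hence near [x] for
    [N] steps, in the past; expansiveness makes it close to [x]. *)
Lemma br_small_s e : 0 < e -> exists2 a, 0 < a & forall x y, Om x -> Om y ->
  d x y < a -> d x y < delta0 -> asymp f e x (br x y).
Proof.
move=> e0; have [b b0 hb] := asymp_small PS e0.
have [N [c [c0 hc]]] := ps_expansive PS b0.
have [a a0 ha] := unif_iter FS N c0.
exists a => // x y Ox Oy xy xyd.
have Oz := ps_brOm PS Ox Oy xyd.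
have hs := ps_brs PS Ox Oy xyd; have hu := ps_bru PS Ox Oy xyd.
apply: hb => //; apply: hc => // k kN; split.
  by apply: le_trans (hs k) _; lra.
apply: le_trans (dT _ (iter k g y) _) _.
have := hu k; have := ha x y Ox Oy xy k kN; lra.
Qed.

End StableLeg.

Section BracketScale.
Variables (f g : X -> X) (br : X -> X -> X).
Hypothesis PS : product_structure f g br.
Let FS := product_structure_flip PS.
Let dxx := psd_refl PS.
Let dC := psd_sym PS.
Let dT := psd_triangle PS.

Lemma br_small e : 0 < e -> exists a, [/\ 0 < a, a <= delta0 &
  forall x y, Om x -> Om y -> d x y < a ->
    [/\ Om (br x y), asymp f e x (br x y) & asymp g e y (br x y)]].
Proof.
move=> e0; have [a a0 ha] := br_small_s PS e0; have [b b0 hb] := br_small_s FS e0.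
exists (Num.min delta0 (Num.min a b)); split.
- by rewrite !lt_min (ps_delta0 PS) a0.
- by rewrite ge_min lexx.
move=> x y Ox Oy; rewrite !lt_min => /and3P[xd xa xb]; split.
- exact: ps_brOm PS _ _ Ox Oy xd.
- exact: ha.
- by apply: hb; rewrite // dC.
Qed.

(** The axioms of a bracket in the sense of Smale spaces, valid below a common
    scale [rho]. *)
Record bracket_scale (rho : R) : Prop := {
  bs_gt0 : 0 < rho;
  bs_Om : forall x y, Om x -> Om y -> d x y < rho -> Om (br x y);
  bs_self : forall x, Om x -> br x x = x;
  bs_brl : forall x y z, Om x -> Om y -> Om z -> d x y < rho -> d x z < rho ->
    d (br x y) z < rho -> br (br x y) z = br x z;
  bs_brr : forall x y z, Om x -> Om y -> Om z -> d y z < rho -> d x z < rho ->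
    d x (br y z) < rho -> br x (br y z) = br x z;
  bs_cont : forall e, 0 < e -> exists2 a, 0 < a & forall x y x' y',
    Om x -> Om y -> Om x' -> Om y' -> d x y < rho -> d x' y' < rho ->
    d x x' < a -> d y y' < a -> d (br x y) (br x' y') < e;
  bs_f : forall x y, Om x -> Om y -> d x y < rho -> d (f x) (f y) < rho ->
    f (br x y) = br (f x) (f y);
  bs_g : forall x y, Om x -> Om y -> d x y < rho -> d (g x) (g y) < rho ->
    g (br x y) = br (g x) (g y);
  bs_asymp : forall x y, Om x -> Om y -> d x y < rho ->
    asymp f (eps0 / 2) x (br x y) /\ asymp g (eps0 / 2) y (br x y) }.

(** All identities hold because both sides lie in the same pair of local
    stable and unstable sets of size [eps0], where uniqueness applies.  For that
    the two legs of each bracket are taken of size at most [eps0 / 4], so that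
    two of them, or the image of one, still fit within [eps0]. *)
Lemma bracket_scale_exists : exists rho, bracket_scale rho.
Proof.
have eps0_gt0 := ps_eps0 PS.
have [b1 b10 hb1] := ps_fcont PS eps0_gt0.
have [b2 b20 hb2] := ps_gcont PS eps0_gt0.
(* The bounds [b1], [b2] keep the image of a leg of size [e] below [eps0]. *)
set e := Num.min (eps0 / 4) (Num.min (b1 / 2) (b2 / 2)).
have e0 : 0 < e by rewrite !lt_min; apply/and3P; split; lra.
have [ee eb1 eb2] : [/\ e <= eps0 / 4, e < b1 & e < b2].
  by have := lexx e; rewrite {2}/e !le_min => /and3P[h1 h2 h3]; split; lra.
have [rho [rho0 rhod hrho]] := br_small e0.
exists rho; split => //.
- by move=> x y Ox Oy xy; case: (hrho x y Ox Oy xy).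
- move=> x Ox; apply/esym; apply: (ps_br_unique PS Ox Ox).
  + by rewrite dxx (ps_delta0 PS).
  + by apply: (asymp_refl PS); lra.
  + by apply: (asymp_refl FS); lra.
- move=> x y z Ox Oy Oz xy xz xyz.
  have [Oxy hs hu] := hrho _ _ Ox Oy xy.
  have [_ hs' hu'] := hrho _ _ Oxy Oz xyz.
  apply: (ps_br_unique PS Ox Oz); first exact: lt_le_trans xz _.
    by apply: asymp_le (asymp_trans PS hs hs'); lra.
  by apply: asymp_le hu'; lra.
- move=> x y z Ox Oy Oz yz xz xyz.
  have [Oyz hs hu] := hrho _ _ Oy Oz yz.
  have [_ hs' hu'] := hrho _ _ Ox Oyz xyz.
  apply: (ps_br_unique PS Ox Oz); first exact: lt_le_trans xz _.
    by apply: asymp_le hs'; lra.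
  by apply: asymp_le (asymp_trans FS hu hu'); lra.
(* The two brackets stay within [eps0 / 4 + eps0 / 2 + eps0 / 4] of each
other for [N] steps, passing through the orbits of [x] and [x'], or of [y]
and [y']. *)
- move=> e' e'0; have [N [a [a0 hexp]]] := ps_expansive PS e'0.
  have e20 : 0 < eps0 / 2 by lra.
  have [c c0 hc] := unif_iter PS N e20; have [c' c'0 hc'] := unif_iter FS N e20.
  exists (Num.min c c'); first by rewrite lt_min c0.
  move=> x y x' y' Ox Oy Ox' Oy' xy x'y'; rewrite !lt_min.
  move=> /andP[xx' _] /andP[_ yy'].
  have [Oz hs hu] := hrho _ _ Ox Oy xy.
  have [Oz' hs' hu'] := hrho _ _ Ox' Oy' x'y'.
  apply: hexp => // k kN; split.
    have := hs k; have := hs' k; have := hc _ _ Ox Ox' xx' k kN.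
    have := dT (iter k f (br x y)) (iter k f x) (iter k f (br x' y')).
    have := dT (iter k f x) (iter k f x') (iter k f (br x' y')).
    rewrite (dC (iter k f (br x y)) (iter k f x)); lra.
  have := hu k; have := hu' k; have := hc' _ _ Oy Oy' yy' k kN.
  have := dT (iter k g (br x y)) (iter k g y) (iter k g (br x' y')).
  have := dT (iter k g y) (iter k g y') (iter k g (br x' y')).
  rewrite (dC (iter k g (br x y)) (iter k g y)); lra.
- move=> x y Ox Oy xy fxy; have [Oz hs hu] := hrho _ _ Ox Oy xy.
  apply: (ps_br_unique PS); [exact: (ps_fOm PS)..|exact: lt_le_trans fxy _| |].
    by apply: asymp_le (asymp_iter 1 hs); lra.
  case=> [|k]; last by rewrite !iterSr !(ps_fK PS); apply: le_trans (hu k) _; lra.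
  by apply/ltW/hb1 => //=; have := hu 0%N => /=; lra.
- move=> x y Ox Oy xy fxy; have [Oz hs hu] := hrho _ _ Ox Oy xy.
  apply: (ps_br_unique PS); [exact: (ps_gOm PS)..|exact: lt_le_trans fxy _| |].
    case=> [|k]; last by rewrite !iterSr !(ps_gK PS); apply: le_trans (hs k) _; lra.
    by apply/ltW/hb2 => //=; have := hs 0%N => /=; lra.
  by apply: asymp_le (asymp_iter 1 hu); lra.
- move=> x y Ox Oy xy; have [_ hs hu] := hrho _ _ Ox Oy xy; split.
    by apply: asymp_le hs; lra.
  by apply: asymp_le hu; lra.
Qed.

End BracketScale.

Section Shadowing.
Variables (f g : X -> X) (br : X -> X -> X).
Hypothesis PS : product_structure f g br.
Let FS := product_structure_flip PS.
Let dxx := psd_refl PS.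
Let dC := psd_sym PS.
Let dT := psd_triangle PS.

Definition pseudo_orbit (a : R) (u : nat -> X) : Prop :=
  forall k, Om (u k) /\ d (f (u k)) (u k.+1) < a.

Lemma pseudo_orbit_shift a u m :
  pseudo_orbit a u -> pseudo_orbit a (fun k => u (m + k)%N).
Proof. by move=> h k; rewrite addnS. Qed.

Lemma pseudo_orbit_iter N e : 0 < e -> exists2 a, 0 < a &
  forall u, pseudo_orbit a u ->
  forall j, (j <= N)%N -> d (iter j f (u 0%N)) (u j) < e.
Proof.
elim: N e => [|N IH] e e0.
  by exists 1 => // u _ j; rewrite leqn0 => /eqP->; rewrite /= dxx.
have e20 : 0 < e / 2 by lra.
have [b b0 hb] := ps_fcont PS e20.
have m0 : 0 < Num.min b e by rewrite lt_min b0.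
have [a a0 ha] := IH _ m0.
exists (Num.min a (e / 2)); first by rewrite lt_min a0.
move=> u hu.
have hua : pseudo_orbit a u.
  by move=> k; have [Ou] := hu k; rewrite lt_min => /andP[].
move=> j; rewrite leq_eqVlt => /predU1P[->|jN]; last first.
  by have := ha u hua j jN; rewrite lt_min => /andP[].
have := ha u hua N (leqnn N); rewrite lt_min => /andP[hN _].
have [OuN] := hu N; rewrite lt_min => /andP[_ uN].
rewrite iterS; apply: le_lt_trans (dT _ (f (u N)) _) _.
have := hb _ _ (iterf_Om PS N (hua 0%N).1) OuN hN; lra.
Qed.

(** Group time in blocks of [N] steps, [N] so large that [N] iterations
    contract local stable sets of size [e] and local unstable sets of size
    [3 * e].  Starting from [x] near [u 0], the corrected point
    [br (u N) (f^N x)] is near [u N] and on the local unstable set of [f^N x].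
    Shadowing the remaining blocks from this corrected point and pulling back,
    the error [e + 2 * e] is contracted to [2 * e]: it does not accumulate, even
    though the contraction has no summable rate. *)
Lemma shadowing t : 0 < t -> exists2 a, 0 < a & forall u, pseudo_orbit a u ->
  forall n, exists w, Om w /\ forall k, (k <= n)%N -> d (iter k f w) (u k) <= t.
Proof.
move=> t0; have eps0_gt0 := ps_eps0 PS.
pose e := Num.min (t / 5) (eps0 / 3).
have e0 : 0 < e by rewrite lt_min; apply/andP; split; lra.
have [et ee] : e <= t / 5 /\ e <= eps0 / 3.
  by split; rewrite ge_min lexx ?orbT.
have [dl [dl0 dld hdl]] := br_small PS e0.
have dl20 : 0 < dl / 2 by lra.
have [N1 hN1] := asymp_contract PS dl20.
have e20 : 0 < 2 * e by lra.
have [N2 hN2] := asymp_contract FS e20.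
pose N := (maxn N1 N2).+1.
have m0 : 0 < Num.min e (dl / 2) by rewrite lt_min e0.
have [a a0 ha] := pseudo_orbit_iter N m0.
exists a => // u hu n.
(* The orbit found is on the local unstable set of the prescribed starting
point [x]; this is what makes the induction close up. *)
suff claim : forall r u, pseudo_orbit a u -> forall x, Om x -> asymp f e (u 0%N) x ->
    exists w, [/\ Om w, asymp g (2 * e) x w &
      forall k, (k <= r * N)%N -> d (iter k f w) (u k) <= 5 * e].
  have [w [Ow _ hw]] := claim n u hu (u 0%N) (hu 0%N).1 (asymp_refl PS _ (ltW e0)).
  exists w; split=> // k kn; apply: le_trans (hw k _) _; last by lra.
  by rewrite (leq_trans kn)// leq_pmulr.
elim=> [|r IH] {hu}u hu x Ox ux.
  exists x; split=> //; first by apply: (asymp_refl FS); lra.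
  move=> k; rewrite mul0n leqn0 => /eqP->.
  by have := ux 0%N; rewrite /= dC; lra.
pose v := iter N f x.
have Ov : Om v by exact: (iterf_Om PS).
have uN : d (u N) v < dl.
  have := ha u hu N (leqnn N); rewrite lt_min => /andP[_ h].
  have N1N : (N1 <= N)%N by rewrite leqW// leq_maxl.
  have h' : d (iter N f (u 0%N)) v < dl / 2.
    by apply: hN1 => //; [exact: (hu 0%N).1|apply: asymp_le ux; lra].
  by apply: le_lt_trans (dT _ (iter N f (u 0%N)) _) _; rewrite dC; lra.
have [Ox1 hs hus] := hdl _ _ (hu N).1 Ov uN.
have us0 : asymp f e (u (N + 0)%N) (br (u N) v) by rewrite addn0.
have [w' [Ow' hw' hk']] := IH _ (pseudo_orbit_shift N hu) _ Ox1 us0.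
have vw' : asymp g (3 * e) v w'.
  by apply: asymp_le (asymp_trans FS hus hw'); lra.
have xE : x = iter N g v by rewrite /v (iter_cancel PS)// subnn.
exists (iter N g w'); split; first exact: (iterg_Om PS).
  move=> k; rewrite xE -!iterD; apply/ltW/hN2 => //.
    by apply: asymp_le vw'; lra.
  by rewrite (leq_trans _ (leq_addl _ _))// leqW// leq_maxr.
move=> k kr; have [kN|/ltnW Nk] := leqP k N.
  rewrite (iter_cancel FS)//.
  have fkx : iter k f x = iter (N - k) g v.
    by rewrite (iter_cancel PS) ?leq_subr// subKn.
  have := ha u hu k kN; rewrite lt_min => /andP[h1 _].
  have := ux k; rewrite fkx => h2; have := vw' (N - k)%N => h3.
  have := dT (iter (N - k) g w') (iter (N - k) g v) (u k).
  have := dT (iter (N - k) g v) (iter k f (u 0%N)) (u k).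
  rewrite (dC (iter (N - k) g w') (iter (N - k) g v)).
  rewrite (dC (iter (N - k) g v) (iter k f (u 0%N))).
  lra.
rewrite -(subnK Nk) iterD (iter_cancel FS)// subnn /= addnC.
by apply: hk'; rewrite leq_subLR -mulSn.
Qed.

End Shadowing.

End ProductStructure.

(** * Markov covers and their cells *)

Section MarkovCover.
Variables (X : Type) (Om : set X) (I : finType) (T : I -> set X).

(** In a rectangle, [br x y = y] says that [y] is on the stable slice of [x],
    and [br y x = y] that it is on the unstable slice of [x]. *)
Definition stab (br : X -> X -> X) (x y : X) : Prop := br x y = y.
Definition unst (br : X -> X -> X) (x y : X) : Prop := br y x = y.

Definition markov_edge (f g : X -> X) (br : X -> X -> X) (x : X) (s t : I) : Prop :=
  [/\ T s x, T t (f x), (forall y, T s y -> stab br x y -> T t (f y)) &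
      (forall y, T t y -> unst br (f x) y -> T s (g y))].

(** On each member [br] is a rectangular band, and Markov edges start and end
    in any prescribed member containing the point. *)
Record markov_cover (f g : X -> X) (br : X -> X -> X) : Prop := {
  mc_fK : cancel f g;
  mc_gK : cancel g f;
  mc_cover : forall x, Om x -> exists i, T i x;
  mc_br : forall i x y, T i x -> T i y -> T i (br x y);
  mc_self : forall i x, T i x -> br x x = x;
  mc_brl : forall i x y z, T i x -> T i y -> T i z -> br (br x y) z = br x z;
  mc_brr : forall i x y z, T i x -> T i y -> T i z -> br x (br y z) = br x z;
  mc_f : forall i j x y, T i x -> T i y -> T j (f x) -> T j (f y) ->
    f (br x y) = br (f x) (f y);
  mc_to : forall x t, T t (f x) -> exists s, markov_edge f g br x s t;
  mc_from : forall x s, T s x -> exists t, markov_edge f g br x s t }.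

Lemma markov_cover_flip f g br :
  markov_cover f g br -> markov_cover g f (fun x y => br y x).
Proof.
case=> fK gK co brc bs bl brr mf mto mfrom; split => //.
- by move=> i x y Tx Ty; exact: brc.
- by move=> i x y z Tx Ty Tz; exact: brr Tz Ty Tx.
- by move=> i x y z Tx Ty Tz; exact: bl Tz Ty Tx.
- move=> i j x y Tx Ty Tgx Tgy; apply: (can_inj fK).
  by rewrite gK (mf j i) ?gK.
- move=> x t /mfrom[s []]; rewrite gK => h1 h2 h3 h4.
  by exists s; split; rewrite ?gK.
- move=> x s; rewrite -{1}(gK x) => /mto[t []]; rewrite !gK => h1 h2 h3 h4.
  by exists t; split; rewrite ?gK.
Qed.

(** Seeing [T j] as the product of an unstable and a stable slice, [T j] meet
    [T k] is a subproduct.  Whether the unstable slice of [x] meets it depends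
    only on the coordinate of [x] along stable slices, and tells whether this
    coordinate is in the corresponding factor; dually for [stab_meets]. *)
Definition unst_meets (br : X -> X -> X) (j k : I) (x : X) : Prop :=
  T j x /\ exists z, [/\ T j z, T k z & unst br x z].
Definition stab_meets (br : X -> X -> X) (j k : I) (x : X) : Prop :=
  T j x /\ exists z, [/\ T j z, T k z & stab br x z].

(** The case [j = k] says that the two points belong to the same members of
    the cover; see [unst_meets_diag]. *)
Definition same_cell (br : X -> X -> X) (x y : X) : Prop := forall j k,
  (unst_meets br j k x <-> unst_meets br j k y) /\
  (stab_meets br j k x <-> stab_meets br j k y).

Lemma same_cell_flip br x y :
  same_cell (fun u v => br v u) x y <-> same_cell br x y.
Proof. by split=> h j k; have [h1 h2] := h j k. Qed.

Section Cells.
Variables (f g : X -> X) (br : X -> X -> X).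
Hypothesis MC : markov_cover f g br.

Lemma same_cell_sym x y : same_cell br x y -> same_cell br y x.
Proof. by move=> h j k; have [[? ?] [? ?]] := h j k. Qed.

Lemma unst_meets_diag j x : unst_meets br j j x <-> T j x.
Proof.
split=> [[]//|Tx]; split=> //; exists x; split=> //.
by rewrite /unst (mc_self MC Tx).
Qed.

Lemma same_cellT j x y : same_cell br x y -> T j x -> T j y.
Proof. by move=> /(_ j j)[h _]; rewrite -!unst_meets_diag => /h. Qed.

Lemma stab_sym j x y : T j x -> T j y -> stab br x y -> stab br y x.
Proof.
by move=> Tx Ty xy; rewrite /stab -{1}xy (mc_brl MC Tx Ty Tx) (mc_self MC Tx).
Qed.

Lemma unst_sym j x y : T j x -> T j y -> unst br x y -> unst br y x.
Proof.
by move=> Tx Ty xy; rewrite /unst -{1}xy (mc_brr MC Tx Ty Tx) (mc_self MC Tx).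
Qed.

(** Any point [p] of a nonempty [T j] meet [T k] can serve to test the
    condition; in this form it is visibly closed in [x]. *)
Lemma unst_meets_br j k p x : T j p -> T k p -> T j x ->
  unst_meets br j k x <-> T k (br p x).
Proof.
move=> Tjp Tkp Tx; split=> [[_ [z [Tjz Tkz xz]]]|Tpx].
  by rewrite -(mc_brr MC Tjp Tjz Tx) xz; exact: (mc_br MC).
split=> //; exists (br p x); split=> //; first exact: (mc_br MC).
by rewrite /unst (mc_brl MC Tjp Tx Tx).
Qed.

(** If [br x y] is in [T k], then the stable slice of [x] and the unstable
    slice of [y] meet [T k] inside [T j]; so does the unstable slice of [x], as
    [x] and [y] are in the same cell.  Both slices of [x] meet the subproduct, so
    [x] is in it. *)
Lemma same_cell_br_T k x y : Om x -> same_cell br x y -> T k (br x y) -> T k x.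
Proof.
move=> Ox xy Tz; have [j Tjx] := mc_cover MC Ox.
have Tjy := same_cellT xy Tjx; have Tjz := mc_br MC Tjx Tjy.
have [h1 _] := xy j k.
have /h1[_ [p [Tjp Tkp xp]]] : unst_meets br j k y.
  by split=> //; exists (br x y); split=> //; by rewrite /unst (mc_brl MC Tjx Tjy Tjy).
have -> : x = br (br x y) p.
  rewrite (mc_brl MC Tjx Tjy Tjp); apply/esym.
  exact: (unst_sym Tjx Tjp xp).
exact: (mc_br MC).
Qed.

(** The point [br x y] shares its stable slice with [x] and its unstable
    slice with [y]. *)
Lemma same_cell_br x y : Om x -> same_cell br x y -> same_cell br x (br x y).
Proof.
move=> Ox xy; set z := br x y.
have Txz i : T i x -> T i z.
  by move=> Tx; apply: (mc_br MC) => //; exact: same_cellT Tx.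
have Tzx i : T i z -> T i x by exact: same_cell_br_T.
move=> j k; have [hu hs] := xy j k; split; split=> -[Tj [p [Tjp Tkp xp]]].
- have Tjy := same_cellT xy Tj.
  have /hu[_ [q [Tjq Tkq yq]]] : unst_meets br j k x by split=> //; exists p.
  split; first exact: Txz.
  exists q; split=> //; rewrite /unst /z (mc_brr MC Tjq Tj Tjy); exact: yq.
- have Tjx := Tzx _ Tj; have Tjy := same_cellT xy Tjx.
  apply/hu; split=> //; exists p; split=> //.
  by rewrite /unst -(mc_brr MC Tjp Tjx Tjy); exact: xp.
- have Tjy := same_cellT xy Tj.
  split; first exact: Txz.
  exists p; split=> //; rewrite /stab /z (mc_brl MC Tj Tjy Tjp); exact: xp.
- have Tjx := Tzx _ Tj; have Tjy := same_cellT xy Tjx.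
  split=> //; exists p; split=> //.
  by rewrite /stab -(mc_brl MC Tjx Tjy Tjp); exact: xp.
Qed.

Lemma stab_image_meets x y j : Om x -> same_cell br x y -> stab br x y ->
  T j (f x) -> T j (f y) /\ stab br (f x) (f y).
Proof.
move=> Ox xy sxy Tfx; have [s [Tsx _ hs _]] := mc_to MC Tfx.
have Tsy := same_cellT xy Tsx; have Tfy := hs y Tsy sxy; split=> //.
by rewrite /stab -(mc_f MC Tsx Tsy Tfx Tfy) sxy.
Qed.

(** The points [f x] and [f y] share their stable slice, so only the unstable
    condition is in question.  A point [z] of [T j] meet [T k] on the unstable
    slice of [f x] is pulled back along two edges to a point [g z] of a [T s]
    meet [T t] on the unstable slice of [x].  As [y] is in the cell of [x], its
    unstable slice also meets [T s] meet [T t], so [br (g z) y] is in it; this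
    point is on the stable slice of [g z], hence goes to [T k] under [f], and to
    the unstable slice of [f y]. *)
Lemma same_cell_image_imp x y j k : Om x -> same_cell br x y -> stab br x y ->
  (unst_meets br j k (f x) -> unst_meets br j k (f y)) /\
  (stab_meets br j k (f x) -> stab_meets br j k (f y)).
Proof.
move=> Ox xy sxy; split=> -[Tfx [z [Tjz Tkz xz]]];
  have [Tfy sfxy] := stab_image_meets Ox xy sxy Tfx; split=> //; last first.
  exists z; split=> //.
  by rewrite /stab -sfxy (mc_brl MC Tfx Tfy Tjz).
have [s [Tsx _ hs hu]] := mc_to MC Tfx.
have Tsy := same_cellT xy Tsx.
have Tsgz : T s (g z) by exact: hu.
have Tkfgz : T k (f (g z)) by rewrite (mc_gK MC).
have Tjfgz : T j (f (g z)) by rewrite (mc_gK MC).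
have [t [Ttgz _ ht _]] := mc_to MC Tkfgz.
have xgz : unst br x (g z).
  apply: (can_inj (mc_fK MC)); rewrite (mc_f MC Tsgz Tsx Tjfgz Tfx) (mc_gK MC).
  exact: xz.
have [hst _] := xy s t.
have /hst[_ [w [Tsw Ttw yw]]] : unst_meets br s t x by split=> //; exists (g z).
pose v := br (g z) w.
have vE : v = br (g z) y by rewrite /v -yw (mc_brr MC Tsgz Tsw Tsy).
have fvE : f v = br z (f y).
  by rewrite vE (mc_f MC Tsgz Tsy Tjfgz Tfy) (mc_gK MC).
exists (f v); split.
- by rewrite fvE; exact: (mc_br MC).
- apply: ht; first exact: (mc_br MC).
  by rewrite /stab (mc_brr MC Ttgz Ttgz Ttw).
- by rewrite /unst fvE (mc_brl MC Tjz Tfy Tfy).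
Qed.

Lemma same_cell_image x y : Om x -> Om y -> same_cell br x y -> stab br x y ->
  same_cell br (f x) (f y).
Proof.
move=> Ox Oy xy sxy; have yx := same_cell_sym xy.
have [j Tjx] := mc_cover MC Ox; have Tjy := same_cellT xy Tjx.
have syx := stab_sym Tjx Tjy sxy.
move=> i k.
have [h1 h2] := same_cell_image_imp i k Ox xy sxy.
by have [h3 h4] := same_cell_image_imp i k Oy yx syx.
Qed.

End Cells.
End MarkovCover.

(** * The cover by shadowing rectangles *)

Section ShadowCover.
Variables (R : realType) (X : Type) (d : X -> X -> R) (Om : set X).
Variables (eps0 delta0 : R).

Definition closed_in (A : set X) : Prop := forall x, Om x ->
  (forall e, 0 < e -> exists2 y, A y & d x y < e) -> A x.

Lemma bracket_scale_flip f g br rho : product_structure d Om eps0 delta0 f g br ->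
  bracket_scale d Om eps0 f g br rho ->
  bracket_scale d Om eps0 g f (fun x y => br y x) rho.
Proof.
move=> PS; have dC := psd_sym PS.
case=> r0 bO bs bl brr bc bf bg ba; split => //.
- by move=> x y Ox Oy xy; apply: bO; rewrite // dC.
- by move=> x y z Ox Oy Oz xy xz xyz; apply: brr; rewrite // dC.
- by move=> x y z Ox Oy Oz yz xz xyz; apply: bl; rewrite // dC.
- move=> e /bc[a a0 ha]; exists a => // x y x' y' Ox Oy Ox' Oy' xy xy' xx' yy'.
  by apply: ha; rewrite // dC.
- by move=> x y Ox Oy xy xy'; apply: bg; rewrite // dC.
- by move=> x y Ox Oy xy xy'; apply: bf; rewrite // dC.
- by move=> x y Ox Oy xy; have [] := ba y x Oy Ox; rewrite // dC.
Qed.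

Variables (I : finType) (p : I -> X) (beta : R).

Definition follows_along (h : X -> X) (x : X) (q : nat -> I) : Prop :=
  forall k, d (iter k h x) (p (q k)) <= beta.

Definition path_of (E : I -> I -> Prop) (q : nat -> I) : Prop :=
  forall k, E (q k) (q k.+1).

Definition follows (h : X -> X) (E : I -> I -> Prop) (s : I) (x : X) : Prop :=
  exists q : nat -> I, [/\ q 0%N = s, path_of E q & follows_along h x q].

Lemma follows_step h E x q : path_of E q -> follows_along h x q ->
  follows h E (q 1%N) (h x).
Proof.
move=> qE hq; exists (fun k => q k.+1); split=> // k.
by rewrite -iterSr.
Qed.

Lemma follows_cons h E s t x : d x (p s) <= beta -> E s t ->
  follows h E t (h x) -> follows h E s x.
Proof.
move=> xs st [q [q0 qE hq]]; exists (fun k => if k is k'.+1 then q k' else s).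
split=> // -[|k] //=; first by rewrite q0.
by have := hq k; rewrite -iterSr.
Qed.

(** Coinduction: a path of the net is chosen step by step. *)
Lemma follows_coind h E (G : I -> X -> Prop) :
  (forall s x, G s x -> d x (p s) <= beta /\ exists2 t, E s t & G t (h x)) ->
  forall s x, G s x -> follows h E s x.
Proof.
move=> hG s x Gsx.
have /choice[nxt hn] : forall sx : I * X, exists t,
    G sx.1 sx.2 -> E sx.1 t /\ G t (h sx.2).
  move=> [t y]; have [/hG[_ [t' tt' Gt']]|nG] := pselect (G t y).
    by exists t'.
  by exists t.
pose step (sx : I * X) := (nxt sx, h sx.2).
have it2 k : (iter k step (s, x)).2 = iter k h x.
  by elim: k => //= k ->.
have itG k : G (iter k step (s, x)).1 (iter k step (s, x)).2.
  by elim: k => //= k IH; exact: (hn _ IH).2.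
exists (fun k => (iter k step (s, x)).1); split=> // k.
  exact: (hn _ (itG k)).1.
by have [] := hG _ _ (itG k); rewrite it2.
Qed.

(** Points that are limits of followers satisfy the hypothesis of
    [follows_coind]: followers near [x] use finitely many first edges, so one
    edge serves at all scales. *)
Lemma follows_closed h E s :
  (forall x y z, d x z <= d x y + d y z) ->
  (forall x, Om x -> Om (h x)) -> unif_continuous_on d Om h ->
  closed_in (Om `&` follows h E s).
Proof.
move=> dT hOm hcont x Ox adh; split=> //.
apply: (@follows_coind h E (fun t z => Om z /\
  (forall e, 0 < e -> exists2 y, (Om `&` follows h E t) y & d z y < e))) => //.
move=> {x Ox adh}{}s x [Ox adh]; split.
  apply/ler_addgt0Pr => e e0; have [y [_ [q [q0 _ hq]]] xy] := adh e e0.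
  have := hq 0%N; rewrite q0 /=; have := dT x y (p s); lra.
pose P t e := exists y, [/\ Om y, E s t, follows h E t (h y) & d (h x) (h y) < e].
have [t ht] : exists t, forall e, 0 < e -> P t e.
  apply: finite_pigeonhole => [t a c ca [y [Oy st hy xy]]|a a0].
    by exists y; split=> //; exact: lt_le_trans ca.
  have [b b0 hb] := hcont a a0.
  have [y [Oy [q [q0 qE hq]]] xy] := adh b b0.
  exists (q 1%N), y; split=> //; last exact: hb.
    by rewrite -q0; exact: qE.
  exact: follows_step.
exists t; first by have [y []] := ht 1 ltr01.
split; first exact: hOm.
by move=> e /ht[y [Oy _ fy xy]]; exists (h y) => //; split=> //; exact: hOm.
Qed.

Variables (rho tau : R).

(** [E] is the edge relation of the net [p].  The precision [tau] of the
    shadowing of paths is finer than the precision [beta] of following, so that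
    the bracket of two shadowing points still follows ([sn_br], [sn_beta]). *)
Record shadowing_net (f g : X -> X) (br : X -> X -> X) (E : I -> I -> Prop) : Prop := {
  sn_ps : product_structure d Om eps0 delta0 f g br;
  sn_scale : bracket_scale d Om eps0 f g br rho;
  sn_beta : 0 < beta /\ tau <= beta / 2;
  sn_rho : 2 * beta < rho;
  sn_eps : 2 * beta <= eps0 / 2;
  sn_f : forall q, path_of E q -> forall n, exists w, Om w /\
    forall k, (k <= n)%N -> d (iter k f w) (p (q k)) <= tau;
  sn_g : forall q, path_of (fun s t => E t s) q -> forall n, exists w, Om w /\
    forall k, (k <= n)%N -> d (iter k g w) (p (q k)) <= tau;
  sn_br : forall x y, Om x -> Om y -> d x y <= 2 * tau ->
    [/\ Om (br x y), asymp d f (beta / 2) x (br x y) &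
      asymp d g (beta / 2) y (br x y)];
  sn_cover : exists c : X -> I, forall x, Om x ->
    d x (p (c x)) <= beta /\ E (c x) (c (f x)) }.

Lemma shadowing_net_flip f g br E : shadowing_net f g br E ->
  shadowing_net g f (fun x y => br y x) (fun s t => E t s).
Proof.
case=> PS BS hb hr he hf hg hbr [c hc]; have dC := psd_sym PS; split => //.
- exact: product_structure_flip.
- exact: (bracket_scale_flip PS).
- by move=> x y Ox Oy xy; have [] := hbr y x Oy Ox; rewrite // dC.
- exists c => x Ox; split; first by have [] := hc x Ox.
  by have [_] := hc _ (ps_gOm PS Ox); rewrite (ps_gK PS).
Qed.

(** The images in Bowen's coding of the cylinders of bi-infinite paths
    through [s]. *)
Definition shadow_rect (f g : X -> X) (E : I -> I -> Prop) (s : I) : set X :=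
  [set x | [/\ Om x, follows f E s x & follows g (fun s t => E t s) s x]].

Lemma shadow_rect_flip f g E s :
  shadow_rect g f (fun s t => E t s) s = shadow_rect f g E s.
Proof. by apply/seteqP; split=> x []. Qed.

Section Following.
Variables (f g : X -> X) (br : X -> X -> X) (E : I -> I -> Prop).
Hypothesis SN : shadowing_net f g br E.
Let PS := sn_ps SN.
Let BS := sn_scale SN.
Let dC := psd_sym PS.
Let dT := psd_triangle PS.
Let E' := fun s t => E t s.
Let T := shadow_rect f g E.

Lemma follows_dist h F s x : follows h F s x -> d x (p s) <= beta.
Proof. by case=> q [<- _ hq]; exact: (hq 0%N). Qed.

Lemma shadow_rect_dist s x y : T s x -> T s y -> d x y <= 2 * beta.
Proof.
move=> [_ /follows_dist xs _] [_ /follows_dist ys _].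
by have := dT x (p s) y; rewrite (dC (p s)); lra.
Qed.

(** For each [n], shadowing gives [w1] along the first [n] steps of [q] and
    [w2] along those of [q'], and [br w1 w2] follows both.  Over these [n] steps
    its orbit stays [eps0]-close to that of [br x y] in both directions, so it
    converges to [br x y] as [n] grows, by expansiveness. *)
Lemma follows_bracket x y q q' : Om x -> Om y -> q 0%N = q' 0%N ->
  path_of E q -> path_of E' q' ->
  follows_along f x q -> follows_along g y q' -> follows_along f (br x y) q.
Proof.
move=> Ox Oy qq' qE q'E fx gy k.
have [b0 tb] := sn_beta SN; have eb := sn_eps SN.
have xy : d x y < rho.
  have := fx 0%N; have := gy 0%N; have := dT x (p (q 0%N)) y; rewrite -qq' /=.
  by have := sn_rho SN; rewrite (dC (p _)); lra.
have Oz := bs_Om BS Ox Oy xy.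
have [hs hu] := bs_asymp BS Ox Oy xy.
apply/ler_addgt0Pr => e e0.
have [a a0 ha] := unif_iter PS k e0.
have [N [c [c0 hc]]] := ps_expansive PS a0.
have [w1 [Ow1 hw1]] := sn_f SN qE (maxn k N).
have [w2 [Ow2 hw2]] := sn_g SN q'E (maxn k N).
have w12 : d w1 w2 <= 2 * tau.
  have := hw1 0%N isT; have := hw2 0%N isT; rewrite -qq' /=.
  by have := dT w1 (p (q 0%N)) w2; rewrite (dC (p _)); lra.
have [Ow ws wu] := sn_br SN Ow1 Ow2 w12; set w := br w1 w2 in Ow ws wu.
have wq j : (j <= maxn k N)%N -> d (iter j f w) (p (q j)) <= beta.
  move=> jN; have := hw1 j jN; have := ws j.
  have := dT (iter j f w) (iter j f w1) (p (q j)).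
  by rewrite (dC (iter j f w) (iter j f w1)); lra.
have wq' j : (j <= maxn k N)%N -> d (iter j g w) (p (q' j)) <= beta.
  move=> jN; have := hw2 j jN; have := wu j.
  have := dT (iter j g w) (iter j g w2) (p (q' j)).
  by rewrite (dC (iter j g w) (iter j g w2)); lra.
have zw : d (br x y) w < a.
  apply: hc => // j jN; have {}jN : (j <= maxn k N)%N by rewrite leq_max jN orbT.
  split.
    have := wq j jN; have := fx j; have := hs j.
    have := dT (iter j f (br x y)) (iter j f x) (iter j f w).
    have := dT (iter j f x) (p (q j)) (iter j f w).
    rewrite (dC (iter j f (br x y)) (iter j f x)) (dC (p (q j))); lra.
  have := wq' j jN; have := gy j; have := hu j.
  have := dT (iter j g (br x y)) (iter j g y) (iter j g w).
  have := dT (iter j g y) (p (q' j)) (iter j g w).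
  rewrite (dC (iter j g (br x y)) (iter j g y)) (dC (p (q' j))); lra.
have := ha _ _ Oz Ow zw k (leqnn k); have := wq k (leq_maxl _ _).
have := dT (iter k f (br x y)) (iter k f w) (p (q k)); lra.
Qed.

End Following.

Section ShadowRect.
Variables (f g : X -> X) (br : X -> X -> X) (E : I -> I -> Prop).
Hypothesis SN : shadowing_net f g br E.
Let NS := shadowing_net_flip SN.
Let PS := sn_ps SN.
Let BS := sn_scale SN.
Let dC := psd_sym PS.
Let dT := psd_triangle PS.
Let E' := fun s t => E t s.
Let T := shadow_rect f g E.

Lemma shadow_rect_step s t x : E s t -> T s x -> follows f E t (f x) -> T t (f x).
Proof.
move=> st [Ox _ gx] fx; split=> //; first exact: (ps_fOm PS).
apply: (follows_cons (follows_dist fx) (st : E' t s)).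
by rewrite (ps_fK PS).
Qed.

Lemma shadow_rect_stepV s t x :
  E s t -> T t x -> follows g E' s (g x) -> T s (g x).
Proof.
move=> st [Ox fx _] gx; split=> //; first exact: (ps_gOm PS).
by apply: (follows_cons (follows_dist gx) st); rewrite (ps_gK PS).
Qed.

(** The bracket follows the forward path of [x] and the backward path of
    [y]. *)
Lemma shadow_rect_br s x y : T s x -> T s y -> T s (br x y).
Proof.
move=> Tx Ty.
have xy : d x y < rho.
  by have := shadow_rect_dist SN Tx Ty; have := sn_rho SN; lra.
have [[Ox [q [q0 qE fq]] _] [Oy _ [q' [q'0 q'E gq']]]] := (Tx, Ty).
have qq' : q 0%N = q' 0%N by rewrite q0.
split; first exact: (bs_Om BS).
  by exists q; split=> //; exact: (follows_bracket SN Ox Oy qq').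
by exists q'; split=> //; exact: (follows_bracket NS Oy Ox (esym qq')).
Qed.

(** The edge is the first one on the forward path [q] of [x].  A point [y] of
    the stable slice of [x] is [br x y], which follows [q] by [follows_bracket],
    so [f y] follows the rest of [q].  For unstable slices, argue in the same way
    with the backward path of [f x] that starts with this edge. *)
Lemma shadow_rect_edge x s : T s x -> exists t, markov_edge T f g br x s t.
Proof.
move=> Tx; have [Ox [q [q0 qE fq]] [q' [q'0 q'E gq']]] := Tx.
have st : E s (q 1%N) by rewrite -q0; exact: qE.
have fx : follows f E (q 1%N) (f x) by exact: follows_step.
exists (q 1%N); split=> //.
- exact: shadow_rect_step st Tx fx.
- move=> y Ty xy; apply: (shadow_rect_step st Ty); apply: follows_step => //.
  have [Oy _ [r [r0 rE gr]]] := Ty.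
  rewrite -xy; apply: (follows_bracket SN Ox Oy _ qE rE fq gr).
  by rewrite q0 r0.
- move=> y Ty xy; apply: (shadow_rect_stepV st Ty).
  have [Oy [r [r0 rE fr]] _] := Ty.
  pose q'' k := if k is k'.+1 then q' k' else q 1%N.
  have q''E : path_of E' q'' by case=> [|k] /=; [rewrite q'0|exact: q'E].
  have gq'' : follows_along g (f x) q''.
    case=> [|k]; first exact: (follows_dist fx).
    by rewrite iterSr (ps_fK PS); exact: gq'.
  rewrite -q'0 -[q' 0%N]/(q'' 1%N); apply: follows_step => //.
  by rewrite -xy; apply: (follows_bracket NS (ps_fOm PS Ox) Oy _ q''E rE gq'' fr).
Qed.

Lemma shadow_rect_closed s : closed_in (T s).
Proof.
move=> x Ox adh; split=> //.
  apply: (follows_closed dT (ps_fOm PS) (ps_fcont PS) Ox _).2.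
  by move=> e /adh[y [Oy fy _] xy]; exists y.
apply: (follows_closed dT (ps_gOm PS) (ps_gcont PS) Ox _).2.
by move=> e /adh[y [Oy _ gy] xy]; exists y.
Qed.

Lemma shadow_rect_cover x : Om x -> exists s, T s x.
Proof.
have [c hc] := sn_cover SN => Ox; exists (c x); split=> //.
  exists (fun k => c (iter k f x)); split=> // k.
    by rewrite iterS; apply: (hc _ _).2; exact: (iterf_Om PS).
  by apply: (hc _ _).1; exact: (iterf_Om PS).
exists (fun k => c (iter k g x)); split=> // k.
  have [_] := hc _ (iterg_Om PS k.+1 Ox).
  by rewrite iterS (ps_gK PS).
by apply: (hc _ _).1; exact: (iterg_Om PS).
Qed.

End ShadowRect.

Lemma shadowing_net_markov_cover f g br E :
  shadowing_net f g br E -> markov_cover Om (shadow_rect f g E) f g br.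
Proof.
move=> SN; have PS := sn_ps SN; have BS := sn_scale SN.
have TO i x : shadow_rect f g E i x -> Om x by case.
have close i x y : shadow_rect f g E i x -> shadow_rect f g E i y -> d x y < rho.
  move=> Tx Ty; have := shadow_rect_dist SN Tx Ty; have := sn_rho SN; lra.
have Tbr := shadow_rect_br SN.
split; [exact: ps_fK PS|exact: ps_gK PS|exact: shadow_rect_cover SN|exact: Tbr| | | | | |].
- by move=> i x /TO; exact: (bs_self BS).
- move=> i x y z Tx Ty Tz.
  apply: (bs_brl BS);
    [exact: TO Tx|exact: TO Ty|exact: TO Tz|exact: close Tx Ty|exact: close Tx Tz|].
  exact: close (Tbr _ _ _ Tx Ty) Tz.
- move=> i x y z Tx Ty Tz.
  apply: (bs_brr BS);
    [exact: TO Tx|exact: TO Ty|exact: TO Tz|exact: close Ty Tz|exact: close Tx Tz|].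
  exact: close Tx (Tbr _ _ _ Ty Tz).
- move=> i j x y Tx Ty Tfx Tfy.
  by apply: (bs_f BS); [exact: TO Tx|exact: TO Ty|exact: close Tx Ty|exact: close Tfx Tfy].
- move=> x t Tfx; have NS := shadowing_net_flip SN.
  have TT : shadow_rect g f (fun s t => E t s) = shadow_rect f g E.
    by apply: funext => s; exact: shadow_rect_flip.
  have := @shadow_rect_edge _ _ _ _ NS; rewrite TT => /(_ _ _ Tfx)[s []].
  rewrite (ps_fK PS) => h1 h2 h3 h4.
  by exists s; split.
- exact: shadow_rect_edge SN.
Qed.

End ShadowCover.

Section CoverExists.
Variables (R : realType) (X : Type) (d : X -> X -> R) (Om : set X).
Variables (eps0 delta0 : R).

Definition has_finite_nets : Prop := forall a, 0 < a ->
  exists (m : nat) (p : 'I_m -> X), (forall i, Om (p i)) /\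
    forall x, Om x -> exists i, d x (p i) < a.

Lemma shadowing_net_exists f g br rho t :
  product_structure d Om eps0 delta0 f g br -> has_finite_nets -> Om !=set0 ->
  bracket_scale d Om eps0 f g br rho -> 0 < t ->
  exists (m : nat) (p : 'I_m -> X) (beta tau : R) (E : 'I_m -> 'I_m -> Prop),
    2 * beta <= t /\ shadowing_net d Om eps0 delta0 p beta rho tau f g br E.
Proof.
move=> PS nets [x0 Ox0] BS t0; have FS := product_structure_flip PS.
have eps0_gt0 := ps_eps0 PS; have rho0 := bs_gt0 BS.
have dC := psd_sym PS; have dT := psd_triangle PS.
pose beta := Num.min (t / 2) (Num.min (rho / 3) (eps0 / 4)).
have b0 : 0 < beta by rewrite !lt_min; apply/and3P; split; lra.
have [bt brho be] : [/\ beta <= t / 2, beta <= rho / 3 & beta <= eps0 / 4].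
  by split; rewrite !ge_min lexx ?orbT.
clearbody beta.
have b20 : 0 < beta / 2 by lra.
have [dl [dl0 dld hdl]] := br_small PS b20.
pose tau := Num.min (beta / 2) (dl / 3).
have tau0 : 0 < tau by rewrite lt_min; apply/andP; split; lra.
have [tb tdl] : tau <= beta / 2 /\ tau <= dl / 3.
  by split; rewrite ge_min lexx ?orbT.
clearbody tau.
have [a1 a10 ha1] := shadowing PS tau0; have [a2 a20 ha2] := shadowing FS tau0.
pose a := Num.min a1 a2.
have a0 : 0 < a by rewrite lt_min a10.
have [aa1 aa2] : a <= a1 /\ a <= a2 by split; rewrite ge_min lexx ?orbT.
clearbody a.
have a120 : 0 < a / 2 by lra.
have [c1 c10 hc1] := ps_fcont PS a120; have [c2 c20 hc2] := ps_gcont PS a120.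
pose e := Num.min (Num.min beta (a / 2)) (Num.min c1 c2).
have e0 : 0 < e by rewrite !lt_min b0 a120 c10.
have [eb ea ec1 ec2] : [/\ e <= beta, e <= a / 2, e <= c1 & e <= c2].
  by split; rewrite !ge_min lexx ?orbT.
have [m [p [pO pn]]] := nets e e0.
have [i0 _] := pn _ Ox0.
have /choice[c hc] : forall x, exists i, Om x -> d x (p i) < e.
  by move=> x; have [/pn[i xi]|nO] := pselect (Om x); [exists i|exists i0].
pose E (s t : 'I_m) := d (f (p s)) (p t) < a /\ d (g (p t)) (p s) < a.
exists m, p, beta, tau, E; split; first lra.
split => //.
- lra.
- lra.
- move=> q qE; apply: (ha1 (p \o q)) => k; split; first exact: pO.
  by have [h _] := qE k; exact: lt_le_trans aa1.
- move=> q qE; apply: (ha2 (p \o q)) => k; split; first exact: pO.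
  by have [_ h] := qE k; exact: lt_le_trans aa2.
- by move=> x y Ox Oy xy; apply: hdl => //; lra.
- exists c => x Ox; have Ofx := ps_fOm PS Ox.
  have xc := hc x Ox; have fxc := hc _ Ofx; split; first lra.
  split.
    have : d (f (p (c x))) (f x) < a / 2 by apply: hc1; rewrite // dC; lra.
    have := dT (f (p (c x))) (f x) (p (c (f x))); lra.
  have : d (g (p (c (f x)))) (g (f x)) < a / 2 by apply: hc2; rewrite // dC; lra.
  have := dT (g (p (c (f x)))) (g (f x)) (p (c x)).
  rewrite (ps_fK PS); lra.
Qed.

End CoverExists.

(** * From a fine Markov cover to a partition *)

Section Partition.
Variables (R : realType) (X : Type) (d : X -> X -> R) (Om : set X).
Variables (eps0 delta0 rho r : R) (I : finType) (T : I -> set X).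

Definition int_in (A : set X) : set X := [set x | Om x /\
  exists2 e, 0 < e & forall y, Om y -> d x y < e -> A y].

Definition clo_in (A : set X) : set X := [set x | Om x /\
  forall e, 0 < e -> exists2 y, A y & d x y < e].

Definition is_cell (br : X -> X -> X) (A : set X) : Prop :=
  forall x, A x -> forall y, A y <-> Om y /\ same_cell T br x y.

(** The factor 4 leaves room for points near the members of the cover:
    [bracket_scale] then applies to them and to their brackets with points of the
    member. *)
Record fine_cover (f g : X -> X) (br : X -> X -> X) : Prop := {
  fc_ps : product_structure d Om eps0 delta0 f g br;
  fc_scale : bracket_scale d Om eps0 f g br rho;
  fc_markov : markov_cover Om T f g br;
  fc_Om : forall i, T i `<=` Om;
  fc_closed : forall i, closed_in d Om (T i);
  fc_diam : forall i x y, T i x -> T i y -> d x y <= r;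
  fc_rho : 4 * r <= rho }.

Lemma fine_cover_flip f g br :
  fine_cover f g br -> fine_cover g f (fun x y => br y x).
Proof.
case=> PS BS MC TO Tc Td rr; split => //.
- exact: product_structure_flip.
- exact: (bracket_scale_flip PS).
- exact: markov_cover_flip.
Qed.

Lemma is_cell_flip br A : is_cell br A -> is_cell (fun x y => br y x) A.
Proof. by move=> h x Ax y; rewrite same_cell_flip; exact: h. Qed.

Section Cells.
Variables (f g : X -> X) (br : X -> X -> X).
Hypothesis FC : fine_cover f g br.
Let PS := fc_ps FC.
Let BS := fc_scale FC.
Let MC := fc_markov FC.
Let dxx := psd_refl PS.
Let dC := psd_sym PS.
Let dT := psd_triangle PS.

Lemma int_in_sub A x : int_in A x -> A x.
Proof. by move=> [Ox [e e0 h]]; apply: h; rewrite // dxx. Qed.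

Lemma int_in_open A x : int_in A x ->
  exists2 e, 0 < e & forall y, Om y -> d x y < e -> int_in A y.
Proof.
move=> [Ox [e e0 h]]; exists (e / 2) => [|y Oy xy]; first lra.
split=> //; exists (e / 2) => [|z Oz yz]; first lra.
by apply: h => //; have := dT x y z; lra.
Qed.

Lemma sub_clo_in A x : Om x -> A x -> clo_in A x.
Proof. by move=> Ox Ax; split=> // e e0; exists x; rewrite // dxx. Qed.

Lemma clo_in_mono A B : A `<=` B -> clo_in A `<=` clo_in B.
Proof.
by move=> AB x [Ox h]; split=> // e /h[y Ay xy]; exists y => //; exact: AB.
Qed.

Lemma clo_in_idem A : clo_in (clo_in A) `<=` clo_in A.
Proof.
move=> x [Ox h]; split=> // e e0; have e20 : 0 < e / 2 by lra.
have [y [_ hy] xy] := h _ e20; have [z Az yz] := hy _ e20.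
by exists z => //; have := dT x y z; lra.
Qed.

Lemma cell_Om A x : is_cell br A -> A x -> Om x.
Proof. by move=> hA Ax; have /(hA x Ax)[] := Ax. Qed.

Lemma cell_same A x y : is_cell br A -> A x -> A y -> same_cell T br x y.
Proof. by move=> hA Ax Ay; have [] := (hA x Ax y).1 Ay. Qed.

Lemma cell_T A x : is_cell br A -> A x -> exists j, A `<=` T j.
Proof.
move=> hA Ax; have [j Tx] := mc_cover MC (cell_Om hA Ax).
by exists j => y Ay; apply: (same_cellT MC _ Tx); exact: cell_same hA Ax Ay.
Qed.

Lemma cell_br A x y : is_cell br A -> A x -> A y -> A (br x y).
Proof.
move=> hA Ax Ay; have Ox := cell_Om hA Ax; have [j Tj] := cell_T hA Ax.
apply/(hA x Ax); split; first by apply: (fc_Om FC (i := j)); apply: (mc_br MC); exact: Tj.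
by apply: (same_cell_br MC Ox); exact: cell_same hA Ax Ay.
Qed.

Lemma cell_dist A x y : is_cell br A -> A x -> A y -> d x y <= r.
Proof.
by move=> hA Ax Ay; have [j Tj] := cell_T hA Ax; apply: (fc_diam FC (i := j)); exact: Tj.
Qed.

(** For [w] near [z = br x y], the points [br w x] and [br y w] are near
    [br z x = x] and [br y z = y], hence in the cell, and so is their bracket,
    which is [w]. *)
Lemma cell_int_br A x y : is_cell br A ->
  int_in A x -> int_in A y -> int_in A (br x y).
Proof.
move=> hA ix iy; have Ax := int_in_sub ix; have Ay := int_in_sub iy.
have rho0 := bs_gt0 BS; have rr := fc_rho FC.
have [j Tj] := cell_T hA Ax; have Tx := Tj _ Ax; have Ty := Tj _ Ay.
set z := br x y; have Az : A z by exact: cell_br.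
have Tz := Tj _ Az.
have [[Ox [e1 e10 h1]] [Oy [e2 e20 h2]]] := (ix, iy).
have Oz := fc_Om FC Tz.
have zx : br z x = x by rewrite /z (mc_brl MC Tx Ty Tx) (mc_self MC Tx).
have yz : br y z = y by rewrite /z (mc_brr MC Ty Tx Ty) (mc_self MC Ty).
pose e := Num.min (Num.min e1 e2) (rho / 4).
have e0 : 0 < e by rewrite !lt_min e10 e20; lra.
have [ee1 ee2 er] : [/\ e <= e1, e <= e2 & e <= rho / 4].
  by split; rewrite !ge_min lexx ?orbT.
clearbody e.
have [a a0 ha] := bs_cont BS e0.
split=> //; exists (Num.min a (rho / 4)); first by rewrite lt_min a0; lra.
move=> w Ow; rewrite lt_min => /andP[zw zwr].
have dzx := fc_diam FC Tz Tx; have dzy := fc_diam FC Tz Ty.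
have dxy := fc_diam FC Tx Ty.
have dwx : d w x < rho by have := dT w z x; rewrite (dC w z); lra.
have dyw : d y w < rho by have := dT y z w; rewrite (dC y z); lra.
pose x' := br w x; pose y' := br y w.
have Ox' : Om x' by exact: (bs_Om BS).
have Oy' : Om y' by exact: (bs_Om BS).
have xx' : d x x' < e.
  by rewrite -{1}zx; apply: ha; rewrite ?dxx//; lra.
have yy' : d y y' < e.
  by rewrite -{1}yz; apply: ha; rewrite ?dxx// dC; lra.
have Ax' : A x' by apply: h1 => //; lra.
have Ay' : A y' by apply: h2 => //; lra.
have dwy' : d w y' < rho.
  by have := dT w z y'; have := dT z y y'; rewrite (dC w z); lra.
have <- : br x' y' = w; last exact: cell_br.
rewrite /x' (bs_brl BS)//; last by have := cell_dist hA Ax' Ay'; lra.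
by rewrite /y' (bs_brr BS)// ?dxx// (bs_self BS).
Qed.

(** For [w] near [y], the point [br w x] is near [x] and on the stable slice
    of [w].  It is therefore in the cell of [x], with image in the cell of [f x],
    and [same_cell_image] carries this over to [f w]. *)
Lemma cell_int_stab A A' x y : is_cell br A -> is_cell br A' ->
  int_in A x -> int_in A' (f x) -> int_in A y -> stab br x y -> int_in A' (f y).
Proof.
move=> hA hA' ix ifx iy sxy; have Ax := int_in_sub ix; have Ay := int_in_sub iy.
have Afx := int_in_sub ifx.
have rho0 := bs_gt0 BS; have rr := fc_rho FC.
have [j Tj] := cell_T hA Ax; have Tx := Tj _ Ax; have Ty := Tj _ Ay.
have yx : br y x = x := stab_sym MC Tx Ty sxy.
have [[Ox [e1 e10 h1]] [Oy [e2 e20 h2]]] := (ix, iy).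
have [Ofx [e3 e30 h3]] := ifx.
have [b b0 hb] := ps_fcont PS e30.
have e0 : 0 < Num.min e1 b by rewrite lt_min e10.
have [a a0 ha] := bs_cont BS e0.
pose e := Num.min (Num.min a e2) (rho / 4).
have ee0 : 0 < e by rewrite !lt_min a0 e20; lra.
have [ea ee2 er] : [/\ e <= a, e <= e2 & e <= rho / 4].
  by split; rewrite !ge_min lexx ?orbT.
clearbody e.
have [c c0 hc] := ps_gcont PS ee0.
split; first exact: (ps_fOm PS).
exists c => // v Ov fyv; pose w := g v.
have Ow : Om w by exact: (ps_gOm PS).
have yw : d y w < e by rewrite -[y](ps_fK PS); apply: hc => //; exact: (ps_fOm PS).
have vE : v = f w by rewrite /w (ps_gK PS).
have Aw : A w by apply: h2 => //; lra.
have Tw := Tj _ Aw.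
have dyx := fc_diam FC Ty Tx; have dwx := fc_diam FC Tw Tx.
pose x' := br w x.
have Ox' : Om x' by apply: (bs_Om BS) => //; lra.
have : d x x' < Num.min e1 b.
  by rewrite -{1}yx; apply: ha; rewrite ?dxx//; lra.
rewrite lt_min => /andP[xx'1 xx'b].
have Ax' : A x' by exact: h1.
have Afx' : A' (f x') by apply: h3; [exact: (ps_fOm PS)|exact: hb].
apply/(hA' _ Afx'); split=> //.
rewrite vE; apply: (same_cell_image MC Ox' Ow); first exact: cell_same hA Ax' Aw.
by rewrite /stab /x' (mc_brl MC Tw Tx Tw) (mc_self MC Tw).
Qed.

(** Approximate [x] by interior points [x'] of the cell whose images are
    interior to the other cell, and [y] by interior points [y'].  Then
    [cell_int_stab] applies to [br x' y'], which tends to [br x y = y]. *)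
Lemma cell_clo_stab A A' x y : is_cell br A -> is_cell br A' ->
  int_in (clo_in (int_in A)) x -> clo_in (int_in A') (f x) ->
  clo_in (int_in A) y -> stab br x y -> clo_in (int_in A') (f y).
Proof.
move=> hA hA' ix [Ofx hfx] [Oy hy] sxy.
have rho0 := bs_gt0 BS; have rr := fc_rho FC.
have [[Ox hx] [_ [e1 e10 h1]]] := (int_in_sub ix, ix).
have dxy : d x y < rho.
  have r40 : 0 < rho / 4 by lra.
  have [x' /int_in_sub Ax' xx'] := hx _ r40.
  have [y' /int_in_sub Ay' yy'] := hy _ r40.
  have := cell_dist hA Ax' Ay'; have := dT x x' y; have := dT x' y' y.
  by rewrite (dC y' y); lra.
split=> [|e e0]; first exact: (ps_fOm PS).
have [b b0 hb] := ps_fcont PS e0.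
have [a a0 ha] := bs_cont BS b0.
have m0 : 0 < Num.min (a / 2) e1 by rewrite lt_min e10; lra.
have [c c0 hc] := ps_gcont PS m0.
(* First move [f x] into the open set [int_in A'], then move its preimage
into [int_in A]; the preimage is in the closure of [int_in A] because [x] is
interior to that closure. *)
have [v iv fxv] := hfx c c0.
have Ov := iv.1; have [e2 e20 h2] := int_in_open iv.
have Ogv := ps_gOm PS Ov.
have : d x (g v) < Num.min (a / 2) e1.
  by rewrite -{1}[x](ps_fK PS); exact: hc.
rewrite lt_min => /andP[xgv xgv1].
have [_ hgv] := h1 _ Ogv xgv1.
have [b2 b20 hb2] := ps_fcont PS e20.
have n0 : 0 < Num.min b2 (a / 2) by rewrite lt_min b20; lra.
have [x' ix'] := hgv _ n0; rewrite lt_min => /andP[gvx'b gvx'].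
have Ox' := ix'.1.
have ifx' : int_in A' (f x').
  by apply: h2; [exact: (ps_fOm PS)|rewrite -[v](ps_gK PS); exact: hb2].
have [y' iy' yy'] := hy a a0.
have iz := cell_int_br hA ix' iy'.
have Ax' := int_in_sub ix'; have Ay' := int_in_sub iy'.
have [j Tj] := cell_T hA Ax'; have Tx' := Tj _ Ax'; have Ty' := Tj _ Ay'.
exists (f (br x' y')).
  apply: (cell_int_stab hA hA' ix' ifx' iz).
  by rewrite /stab (mc_brr MC Tx' Tx' Ty').
apply: hb => //; first exact: iz.1.
rewrite -{1}sxy; apply: ha => //; first exact: iy'.1.
  by have := cell_dist hA Ax' Ay'; lra.
by have := dT x (g v) x'; lra.
Qed.

Lemma unst_meets_closed j k : closed_in d Om (unst_meets T br j k).
Proof.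
move=> x Ox adh; have rho0 := bs_gt0 BS; have rr := fc_rho FC.
have [y0 [Ty0 [p [Tjp Tkp _]]] _] := adh 1 ltr01.
have Tjx : T j x.
  by apply: (fc_closed FC Ox) => e /adh[y [Tjy _] xy]; exists y.
have dpx z : T j z -> d p z < rho.
  by move=> Tz; have := fc_diam FC Tjp Tz; have := d_ge0 PS p z; lra.
have Op := fc_Om FC Tjp.
apply/(unst_meets_br MC Tjp Tkp Tjx); apply: (fc_closed FC).
  by apply: (bs_Om BS) => //; exact: dpx.
move=> e e0; have [a a0 ha] := bs_cont BS e0.
have [y my xy] := adh a a0; have Tjy := my.1.
exists (br p y); first exact/(unst_meets_br MC Tjp Tkp Tjy).
apply: ha; rewrite ?dxx//; [exact: (fc_Om FC Tjy)|exact: dpx|exact: dpx].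
Qed.

(** The boundary of a closed set is nowhere dense: treating the sets one after
    the other, either the current ball lies in the set, or it contains a smaller
    ball disjoint from it. *)
Lemma closed_in_locally_decided (K : finType) (S : K -> set X) :
  (forall k, closed_in d Om (S k)) -> forall x e, Om x -> 0 < e ->
  exists y, [/\ Om y, d x y < e & exists2 e', 0 < e' &
    forall w, Om w -> d y w < e' -> forall k, S k w <-> S k y].
Proof.
move=> clS x e Ox e0.
suff [y [e' [Oy e'0 xe' h]]] : exists y e', [/\ Om y, 0 < e',
    d x y + e' <= e & forall w, Om w -> d y w < e' ->
      forall k, k \in enum K -> (S k w <-> S k y)].
  exists y; split=> //; first lra.
  by exists e' => // w Ow yw k; apply: h; rewrite // mem_enum.
elim: (enum K) => [|k s [y [e' [Oy e'0 xe' h]]]].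
  by exists x, e; split=> //; rewrite dxx add0r.
have [[y' [Oy' yy' nS]]|noy'] :=
    pselect (exists y', [/\ Om y', d y y' < e' & ~ S k y']).
  have [c c0 hc] : exists2 c, 0 < c & forall w, Om w -> d y' w < c -> ~ S k w.
    apply: contrapT => noc; apply: nS; apply: clS => // c c0.
    apply: contrapT => now; apply: noc; exists c => // w Ow y'w Sw.
    by apply: now; exists w.
  pose e'' := Num.min c (e' - d y y').
  have [ec ee'] : e'' <= c /\ e'' <= e' - d y y'.
    by split; rewrite ge_min lexx ?orbT.
  have e''0 : 0 < e'' by rewrite lt_min c0; lra.
  clearbody e''.
  exists y', e''; split=> //; first by have := dT x y y'; lra.
  move=> w Ow y'w k'; rewrite inE => /predU1P[->|k's].
    by split=> [/hc|/nS//] []//; lra.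
  rewrite (h w Ow _ k' k's) ?(h y' Oy' yy' k' k's)//.
  by have := dT y y' w; lra.
exists y, e'; split=> // w Ow yw k'; rewrite inE => /predU1P[->|]; last exact: h.
have inS z : Om z -> d y z < e' -> S k z.
  by move=> Oz yz; apply: contrapT => nS; apply: noy'; exists z.
by split=> _; apply: inS => //; rewrite dxx.
Qed.

End Cells.

Lemma same_cell_dense f g br : fine_cover f g br -> forall x e, Om x -> 0 < e ->
  exists y, [/\ Om y, d x y < e & exists2 e', 0 < e' &
    forall w, Om w -> d y w < e' -> same_cell T br y w].
Proof.
move=> FC x e Ox e0.
pose S (b : bool * (I * I)) := if b.1 then unst_meets T br b.2.1 b.2.2
  else stab_meets T br b.2.1 b.2.2.
have clS b : closed_in d Om (S b).
  case: b => [[] [j k]]; first exact: (unst_meets_closed FC).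
  exact: (unst_meets_closed (fine_cover_flip FC)).
have [y [Oy xy [e' e'0 h]]] := closed_in_locally_decided FC clS Ox e0.
exists y; split=> //; exists e' => // w Ow yw j k.
by split; symmetry; [exact: (h w Ow yw (true, (j, k)))|exact: (h w Ow yw (false, (j, k)))].
Qed.

(** The partition consists of the closures of the interiors of the cells,
    indexed by their truth tables; those of empty interior contribute empty
    rectangles. *)
Lemma fine_cover_partition f g br : fine_cover f g br ->
  exists (m : nat) (B : 'I_m -> set X),
  [/\ forall i x y, B i x -> B i y -> d x y <= r /\ B i (br x y),
      forall i, B i = clo_in (int_in (B i)),
      Om = \bigcup_i B i,
      forall i j, i != j -> int_in (B i) `&` int_in (B j) = set0 &
      forall i j x, int_in (B i) x -> int_in (B j) (f x) ->
        (forall y, B i y -> stab br x y -> B j (f y)) /\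
        (forall y, B j y -> unst br (f x) y -> B i (g y))].
Proof.
move=> FC; have FCg := fine_cover_flip FC.
have PS := fc_ps FC; have BS := fc_scale FC.
have dC := psd_sym PS; have dT := psd_triangle PS; have dxx := psd_refl PS.
have rho0 := bs_gt0 BS; have rr := fc_rho FC.
pose code x := [ffun b : bool * (I * I) =>
  if b.1 then `[< unst_meets T br b.2.1 b.2.2 x >]
  else `[< stab_meets T br b.2.1 b.2.2 x >]].
have codeP x y : code x = code y <-> same_cell T br x y.
  split=> [/ffunP h j k|h].
    have := h (true, (j, k)); have := h (false, (j, k)).
    by rewrite !ffunE /= => hs hu; split; exact: asbool_eq_equiv.
  apply/ffunP => -[b [j k]]; have [hu hs] := h j k; rewrite !ffunE /=.
  by case: b; exact: asbool_equiv_eq.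
pose J := {ffun bool * (I * I) -> bool}.
pose A (c : J) : set X := [set x | Om x /\ code x = c].
have cA c : is_cell br (A c).
  move=> x [Ox <-] y; split=> [[Oy yx]|[Oy /codeP xy]]; split=> //.
  exact/codeP.
pose B c := clo_in (int_in (A c)).
have BOm c x : B c x -> Om x by case.
have BintB c : B c = clo_in (int_in (B c)).
  apply/seteqP; split=> [|x].
    apply: clo_in_mono => x ix.
    have Ox := ix.1; have [e e0 h] := int_in_open FC ix.
    by split=> //; exists e => // y Oy xy; apply: (sub_clo_in FC) => //; exact: h.
  move=> h; apply: (clo_in_idem FC); apply: clo_in_mono h => y.
  exact: (int_in_sub FC).
have Bint c x e : B c x -> 0 < e -> exists2 y, int_in (A c) y & d x y < e.
  by move=> [_ h] /h.
have Bd c x y : B c x -> B c y -> d x y <= r.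
  move=> Bx By; apply/ler_addgt0Pr => e e0; have e20 : 0 < e / 2 by lra.
  have [x' ix' xx'] := Bint _ _ _ Bx e20; have [y' iy' yy'] := Bint _ _ _ By e20.
  have := cell_dist FC (cA c) (int_in_sub FC ix') (int_in_sub FC iy').
  have := dT x x' y; have := dT x' y' y; rewrite (dC y' y); lra.
have Bbr c x y : B c x -> B c y -> B c (br x y).
  move=> Bx By; have Ox := BOm _ _ Bx; have Oy := BOm _ _ By.
  have dxy : d x y < rho by have := Bd _ _ _ Bx By; have := d_ge0 PS x y; lra.
  split=> [|e e0]; first exact: (bs_Om BS).
  have [a a0 ha] := bs_cont BS e0.
  have [x' ix' xx'] := Bint _ _ _ Bx a0; have [y' iy' yy'] := Bint _ _ _ By a0.
  exists (br x' y'); first exact: (cell_int_br FC).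
  apply: ha => //; [exact: ix'.1|exact: iy'.1|].
  have := cell_dist FC (cA c) (int_in_sub FC ix') (int_in_sub FC iy'); lra.
have Bcover x : Om x -> exists c, B c x.
  move=> Ox; pose P c e := exists2 y, int_in (A c) y & d x y < e.
  suff [c hc] : exists c, forall e, 0 < e -> P c e by exists c; split.
  apply: finite_pigeonhole => [c a b ba [y iy xy]|e e0].
    by exists y => //; lra.
  have [y [Oy xy [e' e'0 h]]] := same_cell_dense FC Ox e0.
  exists (code y), y => //; split=> //; exists e' => // w Ow /(h w Ow) yw.
  by apply/(cA (code y) y).
(* Disjoint open sets have closures with disjoint interiors. *)
have Bdisj c c' x : int_in (B c) x -> int_in (B c') x -> c = c'.
  move=> [Ox [e1 e10 h1]] [_ [e2 e20 h2]].
  have e0 : 0 < Num.min e1 e2 by rewrite lt_min e10.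
  have [y iy] := Bint _ _ _ (h1 x Ox (ltac:(by rewrite dxx))) e0.
  rewrite lt_min => /andP[_ xy2].
  have [Oy [e3 e30 h3]] := iy.
  have [z iz yz] := Bint _ _ _ (h2 y Oy xy2) e30.
  by have [_ <-] := h3 z iz.1 yz; have [_] := int_in_sub FC iz.
exists #|J|, (fun i => B (enum_val i)); split => //.
- by move=> i x y Bx By; split; [exact: Bd Bx By|exact: Bbr].
- apply/seteqP; split=> [x /Bcover[c Bc]|x [i _ /BOm]//].
  by exists (enum_rank c) => //=; rewrite enum_rankK.
- move=> i j ij; apply/seteqP; split=> // x [ix jx].
  by move/eqP: ij; apply; apply: enum_val_inj; exact: Bdisj ix jx.
- move=> i j x ix jx; split=> y By sxy.
    apply: (cell_clo_stab FC (cA _) (cA _) ix _ By sxy).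
    exact: (int_in_sub FC jx).
  apply: (cell_clo_stab FCg (is_cell_flip (cA _)) (is_cell_flip (cA _)) jx _ By sxy).
  by rewrite (ps_fK PS); exact: (int_in_sub FC ix).
Qed.

End Partition.

(** * Compact pseudometric spaces *)

Section CappedDistance.
Variables (R : realType) (M : pseudoMetricType R) (K : R).
Hypothesis K_gt0 : 0 < K.

(** The distance may be infinite; capping it at [K], to be taken above the
    scales in use, makes it real and keeps it a pseudometric. *)
Definition cdist (x y : M) : R := fine (Order.min (edist (x, y)) K%:E).

Lemma cdistE x y : (cdist x y)%:E = Order.min (edist (x, y)) K%:E.
Proof.
rewrite fineK// ge0_fin_numE; last by rewrite le_min edist_ge0 lee_fin ltW.
by rewrite gt_min ltry orbT.
Qed.

Lemma cdist_lt x y e : e <= K -> (cdist x y < e) = (edist (x, y) < e%:E)%E.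
Proof. by move=> eK; rewrite -lte_fin cdistE gt_min lte_fin [K < e]ltNge eK orbF. Qed.

Lemma cdist_le x y e : e < K -> (cdist x y <= e) = (edist (x, y) <= e%:E)%E.
Proof. by move=> eK; rewrite -lee_fin cdistE ge_min lee_fin [K <= e]leNgt eK orbF. Qed.

Lemma cdist_refl x : cdist x x = 0.
Proof.
by apply: EFin_inj; rewrite cdistE edist_refl min_l// lee_fin ltW.
Qed.

Lemma cdist_sym x y : cdist x y = cdist y x.
Proof. by rewrite /cdist edist_sym. Qed.

Lemma cdist_triangle x y z : cdist x z <= cdist x y + cdist y z.
Proof.
rewrite -lee_fin EFinD !cdistE.
have K0 : (0 <= K%:E)%E by rewrite lee_fin ltW.
have [hy|hy] := leP (edist (x, y)) K%:E; have [hz|hz] := leP (edist (y, z)) K%:E.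
- by rewrite ge_min edist_triangle.
- by rewrite ge_min leeDr ?edist_ge0// orbT.
- by rewrite ge_min leeDl ?edist_ge0// orbT.
- by rewrite ge_min leeDl// orbT.
Qed.

Lemma nbhs_cdistP x (U : set M) :
  nbhs x U <-> exists2 e, 0 < e & forall y, cdist x y < e -> U y.
Proof.
split=> [/nbhs_ballP[e /= e0 xU]|[e e0 h]].
  exists (Num.min e K) => [|y]; first by rewrite lt_min e0.
  rewrite cdist_lt ?ge_min ?lexx ?orbT// => /edist_lt_ball /= xy.
  by apply/xU/(le_ball _ xy); rewrite ge_min lexx.
pose e' := Num.min e K.
have e'0 : 0 < e' by rewrite lt_min e0.
have [e'e e'K] : e' <= e /\ e' <= K by split; rewrite ge_min lexx ?orbT.
clearbody e'.
apply/nbhs_ballP; exists (e' / 2) => [/=|y xy]; first lra.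
apply: h; apply: le_lt_trans (_ : e' / 2 < e); last lra.
by rewrite cdist_le; [apply: (@edist_fin _ _ _ (x, y)) => //; lra|lra].
Qed.

Lemma compact_cdist_uniform (A : set M) (P : nat -> M -> M -> Prop) : compact A ->
  (forall x y, A x -> A y -> exists c N, 0 < c /\ forall n x' y', (N <= n)%N ->
    cdist x x' < c -> cdist y y' < c -> P n x' y') ->
  exists n, forall x y, A x -> A y -> P n x y.
Proof.
move=> cA hP; have /compact_near_coveringP := compact_setX cA cA.
move=> /(_ nat \oo (fun n p => P n p.1 p.2) _)[]; last first.
  by move=> N _ /(_ N (leqnn N)) h; exists N => x y Ax Ay; exact: (h (x, y)).
move=> [x y] [/= Ax Ay]; have [c [N [c0 h]]] := hP x y Ax Ay.
exists ([set p | cdist x p.1 < c /\ cdist y p.2 < c], [set n | (N <= n)%N]).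
  split; last by exists N.
  exists ([set x' | cdist x x' < c], [set y' | cdist y y' < c]) => //=.
  by split; apply/nbhs_cdistP; exists c.
by move=> [[x' y'] n] /= [[xx' yy'] Nn]; exact: h.
Qed.

Lemma natSinv_small (c : R) : 0 < c ->
  exists N, forall n, (N <= n)%N -> n.+1%:R^-1 < c.
Proof.
move=> c0; have [N _ hN] := near_infty_natSinv_lt (PosNum c0).
by exists N.
Qed.

Lemma compact_unif_continuous_on (A : set M) (h : M -> M) :
  compact A -> continuous h -> unif_continuous_on cdist A h.
Proof.
move=> cA ch e e0; have e20 : 0 < e / 2 by lra.
suff [n hn] : exists n : nat, forall x y, A x -> A y ->
    cdist x y < n.+1%:R^-1 -> cdist (h x) (h y) < e.
  by exists n.+1%:R^-1 => //; rewrite invr_gt0.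
apply: compact_cdist_uniform => // x y _ _.
have /nbhs_cdistP[a a0 ha] : nbhs x [set z | cdist (h x) (h z) < e / 2].
  by apply: (ch x [set w | cdist (h x) w < e / 2]); apply/nbhs_cdistP; exists (e / 2).
have [xy|xy] := leP (a / 2) (cdist x y).
  have a40 : 0 < a / 4 by lra.
  have [N hN] := natSinv_small a40.
  exists (a / 8), N; split=> [|n x' y' Nn xx' yy' x'y']; first lra.
  have := hN n Nn; move: (n.+1%:R^-1) x'y' => s x'y'.
  have := cdist_triangle x x' y; have := cdist_triangle x' y' y.
  by rewrite (cdist_sym y' y); lra.
exists (a / 2), 0%N; split=> [|n x' y' _ xx' yy' _]; first lra.
have h1 : cdist (h x) (h x') < e / 2 by apply: ha; lra.
have h2 : cdist (h x) (h y') < e / 2.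
  by apply: ha; have := cdist_triangle x y y'; lra.
by have := cdist_triangle (h x') (h x) (h y'); rewrite (cdist_sym (h x') (h x)); lra.
Qed.

Lemma compact_finite_nets (A : set M) : compact A -> has_finite_nets cdist A.
Proof.
move=> cA a a0; have /compact_near_coveringP := cA.
pose F := filter_from setT (fun l0 : seq M => [set l : seq M | {subset l0 <= l}]).
have FF : Filter F.
  apply: filter_fromT_filter; first by exists [::].
  move=> l1 l2; exists (l1 ++ l2) => l hl.
  by split=> x xl; apply: hl; rewrite mem_cat xl ?orbT.
move=> /(_ _ F (fun l x => exists2 y, y \in l & A y /\ cdist x y < a) FF)[].
  move=> x Ax.
  exists ([set x' | cdist x' x < a], [set l : seq M | {subset [:: x] <= l}]).
    split=> /=; last by exists [:: x].
    by apply/nbhs_cdistP; exists a => // y; rewrite cdist_sym.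
  move=> [x' l] /= [xx' xl]; exists x => //.
  by apply: xl; rewrite inE.
move=> l0 _ /(_ l0 (fun x => id)) h.
pose l := [seq y <- l0 | `[< A y >]].
exists (size l), (fun i => tnth (in_tuple l) i); split=> [i|x /h[y yl [Ay xy]]].
  by have := mem_tnth i (in_tuple l); rewrite mem_filter => /andP[/asboolP].
have yl' : y \in in_tuple l by rewrite /= mem_filter yl andbT; apply/asboolP.
by have /tnthP[i yi] := yl'; exists i; rewrite -yi.
Qed.

End CappedDistance.

(** * Riemannian manifolds *)

Section Riemannian.
Variables (R : realType) (n : nat) (M : pseudoMetricType R).
Variables (A : smooth_atlas R M n) (g : riemannian_metric A).
Hypothesis metM : is_riemannian g.

Lemma path_length_ge0 x y l : path_length g x y l -> (0 <= l)%E.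
Proof.
elim=> // c u {}y {}l _ _ _ _ l0; apply: adde_ge0 => //.
by apply: integral_ge0 => t _; rewrite lee_fin sqrtr_ge0.
Qed.

Lemma rdist_edist x y : rdist g x y = edist (x, y).
Proof.
have r0 : (0 <= rdist g x y)%E.
  by apply: le_ereal_inf_tmp => l /=; exact: path_length_ge0.
apply/eqP; rewrite eq_le; apply/andP; split.
  apply: le_ereal_inf_tmp => _ [e [e0 xy] <-].
  by apply/ltW/(metM _ _ e0).
apply/lee_addgt0Pr => e e0.
have [|fin] := boolP (rdist g x y \is a fin_num); last first.
  by move: fin; rewrite ge0_fin_numE// -leNgt leye_eq => /eqP->; rewrite addye ?leey.
move=> fin; have re : 0 < fine (rdist g x y) + e.
  by rewrite ltr_wpDl// fine_ge0.
rewrite -[rdist g x y](fineK fin) -EFinD; apply: (@edist_fin _ _ _ (x, y)) => //=.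
by apply/(metM _ _ re); rewrite -{1}[rdist g x y](fineK fin) lte_fin ltrDl.
Qed.

Lemma local_manifold_asymp (h : M -> M) K e x y : 0 < K -> e < K ->
  local_manifold g h e x y <-> asymp (cdist K) h e x y.
Proof.
move=> K0 eK; split=> hxy k; have := hxy k.
  by rewrite rdist_edist cdist_le.
by rewrite rdist_edist cdist_le.
Qed.

Lemma relint_int_in K (Om B : set M) : 0 < K -> B `<=` Om ->
  relint Om B = int_in (cdist K) Om B.
Proof.
move=> K0 BO.
have nbhsE x : Om x -> relint Om B x <-> nbhs x (fun y => Om y -> B y).
  by move=> Ox; rewrite /relint /interior /=; case: (@nbhs_subspaceP _ Om x).
apply/seteqP; split=> x.
  move=> /[dup] /nbhs_subspace_singleton Bx; have Ox := BO _ Bx.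
  move=> /(nbhsE _ Ox)/(nbhs_cdistP K0)[e e0 h].
  by split=> //; exists e => // y Oy /h; apply.
move=> [Ox [e e0 h]]; apply/(nbhsE _ Ox)/(nbhs_cdistP K0).
by exists e => // y xy Oy; exact: h.
Qed.

Lemma closure_clo_in K (Om B : set M) : 0 < K -> B `<=` Om ->
  closure (B : set (subspace Om)) = clo_in (cdist K) Om B.
Proof.
move=> K0 BO; rewrite closure_subspaceW//.
suff : closure B `&` Om = clo_in (cdist K) Om B by [].
apply/seteqP; split=> x.
  move=> [cB Ox]; split=> // e e0.
  have [|y [By xy]] := cB (fun y => cdist K x y < e).
    by apply/(nbhs_cdistP K0); exists e.
  by exists y.
move=> [Ox cB]; split=> // U /(nbhs_cdistP K0)[e /cB[y By xy] h].
by exists y; split=> //; exact: h.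
Qed.

Lemma rdiam_le (B : set M) (t : R) :
  (forall x y, B x -> B y -> (rdist g x y <= t%:E)%E) -> (rdiam g B <= t%:E)%E.
Proof. by move=> h; apply: ge_ereal_sup => _ [[x y] /= [Bx By] <-]; exact: h. Qed.

(** Only expansiveness needs an argument.  Near a pair of distinct points,
    some iterate of [f] or of its inverse separates the orbits by more than
    [eps0], with a margin that survives perturbation; near the diagonal there is
    nothing to prove.  Compactness makes the time and the margin uniform. *)
Lemma lps_product_structure (f finv : M -> M) (Om : set M) (eps0 delta0 : R) :
  compact [set: M] -> closed Om -> cancel f finv -> cancel finv f ->
  continuous f -> continuous finv -> f @` Om = Om ->
  local_product_structure g f finv Om eps0 delta0 ->
  product_structure (cdist (eps0 + 1)) Om eps0 delta0 f finv
    (bracket g f finv eps0).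
Proof.
move=> cM clO fK gK cf cg fO [e00 d00 de lps].
have cO : compact Om by apply: (subclosed_compact clO cM).
(* Any cap above [eps0] is invisible to local manifolds and to [delta0]. *)
set K := eps0 + 1; have K0 : 0 < K by rewrite /K; lra.
have eK : eps0 < K by rewrite /K; lra.
have fOm x : Om x -> Om (f x) by move=> Ox; rewrite -fO; exists x.
have gOm x : Om x -> Om (finv x) by rewrite -{1}fO => -[y Oy <-]; rewrite fK.
have WP h x y : local_manifold g h eps0 x y <-> asymp (cdist K) h eps0 x y.
  exact: local_manifold_asymp.
have citer (h : M -> M) : continuous h -> forall k, continuous (iter k h).
  move=> ch; elim=> [|k IH] x; first exact: cvg_id.
  exact: (@continuous_comp _ _ _ (iter k h) h x (IH x) (ch _)).
have brP x y : Om x -> Om y -> cdist K x y < delta0 ->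
    Om (bracket g f finv eps0 x y) /\
    local_manifold g f eps0 x `&` local_manifold g finv eps0 y =
      [set bracket g f finv eps0 x y].
  move=> Ox Oy xy; have [|z [Oz zE]] := lps x y Ox Oy.
    by rewrite rdist_edist -(cdist_lt (K := K))// /K; lra.
  suff -> : bracket g f finv eps0 x y = z by [].
  by rewrite /bracket zE; apply: xget_unique.
have xx (h : M -> M) x : asymp (cdist K) h eps0 x x by move=> k; rewrite cdist_refl// ltW.
split => //.
- exact: cdist_refl.
- exact: cdist_sym.
- exact: cdist_triangle.
- exact: compact_unif_continuous_on.
- exact: compact_unif_continuous_on.
- move=> e e0.
  suff [N hN] : exists N : nat, forall x y, Om x -> Om y ->
      (forall k, (k <= N)%N ->
        cdist K (iter k f x) (iter k f y) <= eps0 + N.+1%:R^-1 /\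
        cdist K (iter k finv x) (iter k finv y) <= eps0 + N.+1%:R^-1) ->
      cdist K x y < e.
    by exists N, N.+1%:R^-1; split=> //; rewrite invr_gt0.
  have escape (h : M -> M) x y k : continuous h ->
      eps0 < cdist K (iter k h x) (iter k h y) ->
      exists c N, 0 < c /\ forall m x' y', (N <= m)%N ->
        cdist K x x' < c -> cdist K y y' < c ->
        ~ forall j, (j <= m)%N ->
          cdist K (iter j h x') (iter j h y') <= eps0 + m.+1%:R^-1.
    move=> ch xy; pose b := (cdist K (iter k h x) (iter k h y) - eps0) / 3.
    have b0 : 0 < b by rewrite /b; lra.
    have [c c0 hc] := compact_unif_continuous_on K0 cM (citer h ch k) b0.
    have [N hN] := natSinv_small b0.
    exists c, (maxn k N); split=> // m x' y'; rewrite geq_max => /andP[km Nm].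
    move=> xx' yy' /(_ k km); have := hN m Nm.
    move: (m.+1%:R^-1) => s.
    have := hc _ _ I I xx'; have := hc _ _ I I yy'.
    have := cdist_triangle K0 (iter k h x) (iter k h x') (iter k h y).
    have := cdist_triangle K0 (iter k h x') (iter k h y') (iter k h y).
    rewrite (cdist_sym K (iter k h y') (iter k h y)) /b; lra.
  apply: (compact_cdist_uniform K0) => // x y Ox Oy.
  have [nf|/existsNP[k /negP]] :=
      pselect (forall k, cdist K (iter k f x) (iter k f y) <= eps0); last first.
    rewrite -ltNge => /(escape _ _ _ _ cf)[c [N [c0 h]]].
    exists c, N; split=> // m x' y' Nm xx' yy' hm.
    by case: (h m x' y' Nm xx' yy') => j /hm[].
  have [ng|/existsNP[k /negP]] :=
      pselect (forall k, cdist K (iter k finv x) (iter k finv y) <= eps0); last first.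
    rewrite -ltNge => /(escape _ _ _ _ cg)[c [N [c0 h]]].
    exists c, N; split=> // m x' y' Nm xx' yy' hm.
    by case: (h m x' y' Nm xx' yy') => j /hm[].
  (* Orbits that never separate: the bracket of [x] with itself is both points. *)
  have xy : x = y.
    have [|_ bE] := brP x x Ox Ox; first by rewrite cdist_refl.
    have -> : y = bracket g f finv eps0 x x.
      by have : [set bracket g f finv eps0 x x] y by rewrite -bE; split; apply/WP.
    by have : [set bracket g f finv eps0 x x] x by rewrite -bE; split; apply/WP.
  exists (e / 2), 0%N; split=> [|m x' y' _]; first lra.
  rewrite -xy => xx' xy' _; have := cdist_triangle K0 x' x y'.
  by rewrite (cdist_sym K x' x); lra.
- by move=> x y Ox Oy /(brP x y Ox Oy)[].
- move=> x y Ox Oy /(brP x y Ox Oy)[_ /seteqP[_ /(_ _ erefl)[h _]]].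
  exact/WP.
- move=> x y Ox Oy /(brP x y Ox Oy)[_ /seteqP[_ /(_ _ erefl)[_ h]]].
  exact/WP.
- move=> x y z Ox Oy /(brP x y Ox Oy)[_ /seteqP[h _]] xz yz.
  by apply: h; split; apply/WP.
Qed.

End Riemannian.

Unset Implicit Arguments.

Theorem theorem8p5 (R : realType) (n : nat) (M : pseudoMetricType R)
  (A : smooth_atlas R M n) (g : riemannian_metric A)
  (hausM : hausdorff_space M) (compM : compact [set: M])
  (metM : is_riemannian g)
  (r : nat) (r_ge1 : (1 <= r)%N)
  (f finv : M -> M) (diff_f : Ck_diffeomorphism A r f finv)
  (axA : axiom_A g f finv)
  (Om : set M) (basic_Om : basic_set f Om)
  (eps0 delta0 : R) (lps : local_product_structure g f finv Om eps0 delta0) :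
  forall eps : R, 0 < eps ->
    exists (m : nat) (B : 'I_m -> set M),
      markov_partition g f finv Om eps0 delta0 B /\
      forall i, (rdiam g (B i) < eps%:E)%E.
Proof.
move=> eps eps_gt0.
have [fK gK [cf _] [cg _]] := diff_f.
have [Om0 clO fO] : [/\ Om !=set0, closed Om & f @` Om = Om].
  have [s [F [i [[_ _ hF] ->]]]] := basic_Om.
  by have [] := hF i.
have PS := lps_product_structure metM compM clO fK gK cf cg fO lps.
have [e00 d00 de _] := lps.
set K := eps0 + 1 in PS; have K0 : 0 < K by rewrite /K; lra.
have [rho BS] := bracket_scale_exists PS.
have rho0 := bs_gt0 BS.
(* The factor 4 is the one of [fine_cover]; it also gives strict inequalities. *)
pose t := Num.min (Num.min eps delta0) rho / 4.
have t0 : 0 < t by rewrite divr_gt0// !lt_min eps_gt0 d00.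
have [teps td trho] : [/\ t < eps, t < delta0 & 4 * t <= rho].
  have : Num.min (Num.min eps delta0) rho <= eps by rewrite !ge_min lexx.
  have : Num.min (Num.min eps delta0) rho <= delta0 by rewrite !ge_min lexx orbT.
  have : Num.min (Num.min eps delta0) rho <= rho by rewrite !ge_min lexx orbT.
  by rewrite /t => ? ? ?; split; lra.
clearbody t.
have cO : compact Om by exact: subclosed_compact clO compM _.
have [m [p [beta [tau [E [bt SN]]]]]] :=
  shadowing_net_exists PS (compact_finite_nets K0 cO) Om0 BS t0.
have FC : fine_cover (cdist K) Om eps0 delta0 rho t
    (shadow_rect (cdist K) Om p beta f finv E) f finv (bracket g f finv eps0).
  split=> //.
  - exact: shadowing_net_markov_cover SN.
  - by move=> i x [].
  - by move=> i; exact: shadow_rect_closed SN i.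
  - by move=> i x y Tx Ty; exact: le_trans (shadow_rect_dist SN Tx Ty) bt.
have [m' [B [Br Bprop BOm Bdisj BM]]] := fine_cover_partition FC.
have BO i : B i `<=` Om by rewrite Bprop => x [].
have iE i : relint Om (B i) = int_in (cdist K) Om (B i) by exact: relint_int_in.
have diamB i : (rdiam g (B i) <= t%:E)%E.
  apply: rdiam_le => x y Bx By; have [] := Br i x y Bx By.
  by rewrite rdist_edist// cdist_le// /K; lra.
have Bclo i : B i = closure (relint Om (B i) : set (subspace Om)).
  rewrite iE (closure_clo_in K0) -?Bprop// => x [] //.
have WP h x y : local_manifold g h eps0 x y <-> asymp (cdist K) h eps0 x y.
  by apply: local_manifold_asymp => //; rewrite /K; lra.
exists m', B; split; last by move=> i; apply: le_lt_trans (diamB i) _; rewrite lte_fin.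
split=> //.
- move=> i; split=> //; last by rewrite Bclo; exact: closed_closure.
  split=> //; first by apply: le_lt_trans (diamB i) _; rewrite lte_fin.
  by move=> x y Bx By; have [] := Br i x y Bx By.
- by move=> i j ij; rewrite !iE; exact: Bdisj.
- move=> i j x; rewrite !iE => ix jfx; have [hs hu] := BM i j x ix jfx.
  have Bx := int_in_sub FC ix; have Bfx := int_in_sub FC jfx.
  have close k u v : B k u -> B k v -> cdist K u v < delta0.
    by move=> Bu Bv; have [h _] := Br k u v Bu Bv; lra.
  split=> [y [/WP wy By]|_ [y [/WP wy By] <-]].
    have uy : unst (bracket g f finv eps0) (f x) y.
      apply/esym; apply: (ps_br_unique PS (BO _ _ By) (BO _ _ Bfx)) => //.
        exact: close By Bfx.
      by apply: (asymp_refl PS); exact: ltW.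
    exists (finv y); last exact: gK.
    split; last exact: hu.
    by apply/WP => k; have := wy k.+1; rewrite !iterSr fK.
  have sy : stab (bracket g f finv eps0) x y.
    apply/esym; apply: (ps_br_unique PS (BO _ _ Bx) (BO _ _ By)) => //.
      exact: close Bx By.
    by apply: (asymp_refl (product_structure_flip PS)); exact: ltW.
  split; last exact: hs.
  by apply/WP; exact: (asymp_iter 1 wy).
Qed.
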